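(* Let $(G,H)=(\mathrm{Sp}_{2n}(\mathbb F),\mathrm{Sp}_{2m}(\mathbb F)\times\mathrm{Sp}_{2n-2m}(\mathbb F))$ with $0<m<n$ and let $0\le r\le n$. (1) When $r<\min(2m,2n-2m)$, the unique open $H$-orbit in $\mathrm{Gr}_G(r)$ is $$\begin{cases}\mathcal O(0,0,0,r)&\text{if }r\text{ is even},\\ \mathcal O(0,0,1,r-1)&\text{if }r\text{ is odd}.\end{cases}$$ (2) When $\min(2m,2n-2m)\le r\le n$, the unique open $H$-orbit in $\mathrm{Gr}_G(r)$ is $$\begin{cases}\mathcal O(0,r-2m,0,2m)&\text{if }m\le n-m,\\ \mathcal O(r-2n+2m,0,0,2n-2m)&\text{if }m\ge n-m.\end{cases}$$
   Context: $\mathbb F$ is an infinite field, $V\simeq\mathbb F^{2n}$ has a nondegenerate symplectic (alternating bilinear) form $B$, $V=U\oplus W$ with $U\perp W$, $\dim U=2m$, $\dim W=2n-2m$. $G$ is the isometry group of $V$ and $H$ the product of the isometry groups of $U$ and $W$. $\mathrm{Gr}_G(r)$ is the projective variety of $r$-dimensional subspaces $S$ of $V$ with $S\perp S$; ''open'' refers to the Zariski topology on $\mathrm{Gr}_G(r)$ (points being subspaces of $V$). For a subspace $X$, $\mathrm{Rad}(X)=X\cap X^\perp$; $\mathbf P_US=(S+W)\cap U$, $\mathbf P_WS=(S+U)\cap W$. For $S\in\mathrm{Gr}_G(r)$: $r_U(S)=\dim(S\cap U)$, $r_W(S)=\dim(S\cap W)$, $a(S)=\dim\frac{\mathrm{Rad}(\mathbf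 P_US)}{S\cap U}=\dim\frac{\mathrm{Rad}(\mathbf P_WS)}{S\cap W}$, $b(S)=\dim\frac{\mathbf P_US}{\mathrm{Rad}(\mathbf P_US)}$. The 4-tuple $(r_U(S),r_W(S),a(S),b(S))$ determines the $H$-orbit of $S$; $\mathcal O(r_U,r_W,a,b)$ denotes the $H$-orbit with this 4-tuple. *)

(* Defs.v *)
From mathcomp Require Import all_boot all_order all_algebra.
From mathcomp.multinomials Require Import mpoly.

Set Implicit Arguments.
Unset Strict Implicit.
Unset Printing Implicit Defensive.

Import GRing.Theory.
Local Open Scope ring_scope.

Section Grassmannian.
Variables (F : fieldType) (V : vectType F) (B : {skew_symmetric V}) (r : nat).

Definition isoGr (S : {vspace V}) : bool :=
  (\dim S == r) && (S <= orthov B S)%VS.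

(* A set of r columns is encoded by its increasing enumeration. *)
Definition plucker_index (N : nat) : {set {ffun 'I_r -> 'I_N}} :=
  [set f : {ffun 'I_r -> 'I_N} |
     [forall i : 'I_r, forall j : 'I_r, (i < j)%N ==> (f i < f j)%N]].

Definition plucker_dim : nat := #|plucker_index (\dim {:V})|.

(* Homogeneous coordinates of S under Gr(r, V) -> P(Lambda^r V): the r x r
   minors of the coordinate matrix of a basis of S.  Only
   used when \dim S = r; changing the basis of S rescales them all by a common
   nonzero factor. *)
Definition plucker (S : {vspace V}) (k : 'I_plucker_dim) : F :=
  \det (\matrix_(i < r, j < r) coord (vbasis fullv) (enum_val k j) (vbasis S)`_i).

(* Zariski topology on isoGr as a subset of P(Lambda^r V). *)
Definition zariski_closed (Z : {vspace V} -> Prop) : Prop :=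
  exists I : {mpoly F[plucker_dim]} -> Prop,
    (forall p, I p -> exists d, p \is d.-homog) /\
    (forall S, Z S <-> isoGr S /\ forall p, I p -> p.@[plucker S] = 0).

Definition zariski_open (X : {vspace V} -> Prop) : Prop :=
  (forall S, X S -> isoGr S) /\ zariski_closed (fun S => isoGr S /\ ~ X S).

End Grassmannian.

Section Orbits.
Variables (F : fieldType) (V : vectType F) (B : {skew_symmetric V}).
Variables (U W : {vspace V}).

Definition is_isometry (X : {vspace V}) (h : 'End(subvs_of X)) : Prop :=
  lker h = 0%VS /\ forall x y, B (vsval (h x)) (vsval (h y)) = B (vsval x) (vsval y).

(* g is the action of a pair (h1, h2) in Isom(U) x Isom(W) on V = U (+) W. *)
Definition in_H (g : 'End(V)) : Prop :=
  exists (h1 : 'End(subvs_of U)) (h2 : 'End(subvs_of W)),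
    [/\ is_isometry h1, is_isometry h2 &
        forall x y, g (vsval x + vsval y) = vsval (h1 x) + vsval (h2 y)].

Definition H_orbit (S T : {vspace V}) : Prop :=
  exists g : 'End(V), in_H g /\ T = (g @: S)%VS.

Definition is_H_orbit (r : nat) (X : {vspace V} -> Prop) : Prop :=
  exists2 S, isoGr B r S & forall T, X T <-> H_orbit S T.

Definition Rad (X : {vspace V}) : {vspace V} := (X :&: orthov B X)%VS.

Definition PU (S : {vspace V}) : {vspace V} := ((S + W) :&: U)%VS.
Definition PW (S : {vspace V}) : {vspace V} := ((S + U) :&: W)%VS.

Definition rU (S : {vspace V}) : nat := \dim (S :&: U).
Definition rW (S : {vspace V}) : nat := \dim (S :&: W).

(* Dimensions of quotients; for isotropic S and U orthogonal to W the
   subtractions do not truncate, and a can be computed on either summand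
   (see a_PW). *)
Definition a (S : {vspace V}) : nat := (\dim (Rad (PU S)) - \dim (S :&: U))%N.
Definition b (S : {vspace V}) : nat := (\dim (PU S) - \dim (Rad (PU S)))%N.

Definition orbitO (r : nat) (t : nat * nat * nat * nat) (S : {vspace V}) : Prop :=
  isoGr B r S /\ (rU S, rW S, a S, b S) = t.

Definition is_unique_open_orbit (r : nat) (O : {vspace V} -> Prop) : Prop :=
  [/\ is_H_orbit r O, zariski_open B r O &
      forall X, is_H_orbit r X -> zariski_open B r X -> forall S, X S <-> O S].

End Orbits.

Section IndependenceOfSummand.
Variables (F : fieldType) (V : vectType F) (B : {skew_symmetric V}).
Implicit Types (U W S : {vspace V}).

Lemma dim_cap_RadPU U W S : (U :&: W = 0)%VS ->
  (\dim (S :&: (Rad B (PU U W S) + W)) =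
   \dim (Rad B (PU U W S)) + \dim (S :&: W))%N.
Proof.
move=> UW0; set R := Rad B _; set T := (S :&: _)%VS.
have RPU : (R <= PU U W S)%VS by exact: capvSl.
have RU : (R <= U)%VS by apply: subv_trans RPU _; exact: capvSr.
have RW0 : (R :&: W = 0)%VS by apply/eqP; rewrite -subv0 -UW0 capvS.
have TW : (T + W = R + W)%VS.
  apply/eqP; rewrite eqEsubv !subv_add !addvSr capvSr !andbT /=.
  apply/subvP=> u uR; have := subvP RPU _ uR.
  rewrite memv_cap => /andP[/memv_addP[s sS [w wW eu]] _].
  rewrite eu; apply: memv_add => //; rewrite memv_cap sS.
  by rewrite -[s](addrK w) -eu memv_add ?memvN.
have TcW : (T :&: W = S :&: W)%VS.
  by rewrite /T -capvA; congr (_ :&: _)%VS; apply/capv_idPr; exact: addvSr.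
have := dimv_sum_cap T W.
by rewrite TW TcW dimv_disjoint_sum // addnAC => /addIn ->.
Qed.

Lemma cap_RadPU_sub U W S : (S <= orthov B S)%VS -> (U <= orthov B W)%VS ->
  (S :&: (Rad B (PU U W S) + W) <= S :&: (Rad B (PW U W S) + U))%VS.
Proof.
move=> /orthovP SS /orthovP UW; apply/subvP=> x.
rewrite !memv_cap => /andP[xS /memv_addP[u uR [w wW ex]]].
have ew : w = x - u by rewrite ex addrC addKr.
rewrite xS /= ex addrC; move: uR; rewrite memv_cap => /andP[uP /mem_orthovP uO].
have uU : u \in U by move: uP; rewrite memv_cap => /andP[].
apply: memv_add => //; rewrite memv_cap; apply/andP; split.
  by rewrite memv_cap wW ew memv_add ?memvN.
apply/mem_orthovP => w'.
rewrite memv_cap => /andP[/memv_addP[s sS [v vU ew']] w'W].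
have es : s = w' - v by rewrite ew' addrK.
have vP : v \in PU U W S.
  rewrite memv_cap vU andbT.
  have -> : v = - s + w' by rewrite ew' addKr.
  by rewrite memv_add ?memvN.
have Bvw : B v w = 0 by exact: UW.
rewrite ew' linearDr /= [B w v]hermC Bvw !mulr0 addr0 ew linearBl /= SS // sub0r.
by rewrite es linearBr /= UW // uO // subrr oppr0.
Qed.

Lemma a_PW U W S :
    (U :&: W = 0)%VS -> (S <= orthov B S)%VS -> (U <= orthov B W)%VS ->
  a B U W S = (\dim (Rad B (PW U W S)) - \dim (S :&: W))%N.
Proof.
move=> UW0 SS UW; have WU : (W <= orthov B U)%VS by rewrite orthov_sym.
have e : (S :&: (Rad B (PU U W S) + W) = S :&: (Rad B (PW U W S) + U))%VS.
  apply/eqP; rewrite eqEsubv cap_RadPU_sub //=.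
  exact: (@cap_RadPU_sub W U S).
have WU0 : (W :&: U = 0)%VS by rewrite capvC.
have := dim_cap_RadPU S UW0; rewrite e (dim_cap_RadPU S WU0) => eD.
rewrite /a -(subnDr (\dim (S :&: W))) -eD.
by rewrite [X in (_ - X)%N]addnC subnDr.
Qed.

End IndependenceOfSummand.

(* Main.v *)
Require Import Defs.
From mathcomp Require Import all_boot all_order all_algebra.
From HB Require Import structures.
From Stdlib Require Import Classical_Prop.
From mathcomp Require Import fingroup perm ring zify.
From mathcomp.multinomials Require Import mpoly.

Set Implicit Arguments.
Unset Strict Implicit.
Unset Printing Implicit Defensive.

Import GRing.Theory.
Local Open Scope ring_scope.

(* Let r_S be the radical of the alternating form B (p_U s, p_U t) on an isotropic
   S. The orbits of the theorem are those where its dimension q is the smallest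
   possible and r_S meets U (and W, when r < min(2m, 2n - 2m)) trivially. This
   says that the Gram matrix of the form, bordered by the pairings of S with q
   vectors of W on one side and q vectors of U or W on the other, is invertible
   for a suitable choice of these vectors. By a Cauchy-Binet expansion the
   bordered determinant is a quadratic form in the Pluecker coordinates, so the
   orbit is open. That such subspaces form one orbit follows from Witt's theorem
   applied in U and in W. Witt's theorem by transvections also joins any two
   isotropic subspaces by a polynomial curve, so that, F being infinite, any two
   nonempty open sets meet; hence the open orbit is unique. *)

(** The Gram determinant alone is no criterion: an alternating form is degenerate when r is odd, and
    when r > 2m the form B (p_U s, p_U t) has rank at most 2m < r. The border absorbs the
    unavoidable radical: q is 0 or 1 by parity in the first range, and r - 2m in the second when m
    <= n - m, because then dim (S :&: W) >= r - 2m. If the bordered matrix is invertible, pairing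
    with either border is injective on r_S, so dim r_S <= q. Since S is isotropic, S :&: U and S :&:
    W lie in r_S, and U is orthogonal to W, so border vectors in W annihilate S :&: U and those in U
    annihilate S :&: W. The summand supplying a border thus decides which of r_S :&: U = 0 and r_S
    :&: W = 0 is imposed. Once these are known, dim r_S <= q determines the whole 4-tuple. The case
    m >= n - m follows by exchanging U and W: isotropy of S makes the form built on p_W the opposite
    of the one built on p_U, so r_S is unchanged. *)

(** * Increasing maps as representatives of injections modulo permutations *)

Section IncreasingMaps.
Variables (r N : nat).
Implicit Types (K g : {ffun 'I_r -> 'I_N}) (s : 'S_r).

Lemma plucker_indexP K :
  reflect (forall i j : 'I_r, (i < j)%N -> (K i < K j)%N) (K \in plucker_index r N).
Proof.
rewrite inE; apply: (iffP forallP) => [h i j|h i].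
  by move/forallP: (h i) => /(_ j) /implyP.
by apply/forallP => j; apply/implyP; apply: h.
Qed.

Lemma plucker_index_inj K : K \in plucker_index r N -> injective K.
Proof.
move/plucker_indexP => h i j e; apply: val_inj; apply/eqP.
by case: ltngtP => // /h; rewrite e ltnn.
Qed.

Definition perm_ffun (p : {ffun 'I_r -> 'I_N} * 'S_r) : {ffun 'I_r -> 'I_N} :=
  [ffun i => p.1 (p.2 i)].

(** The list of values of an increasing map is strictly sorted, hence determined by its elements. *)
Lemma plucker_index_uniq K K' :
    K \in plucker_index r N -> K' \in plucker_index r N ->
  (forall x, (exists i, K i = x) <-> (exists i, K' i = x)) -> K = K'.
Proof.
move=> hK hK' e.
have srt H : H \in plucker_index r N ->
    sorted ltn [seq val (H i) | i <- enum 'I_r].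
  move/plucker_indexP => h.
  have : sorted ltn (map val (enum 'I_r)) by rewrite val_enum_ord iota_ltn_sorted.
  rewrite !sorted_map; apply: sub_sorted => i j; exact: h.
have mem H x : (x \in [seq val (H i) | i <- enum 'I_r]) <-> exists i : 'I_r, val (H i) = x.
  split=> [/mapP[i _ ->]|[i <-]]; first by exists i.
  by apply: map_f; rewrite mem_enum.
have eqs : [seq val (K i) | i <- enum 'I_r] = [seq val (K' i) | i <- enum 'I_r].
  apply: (irr_sorted_eq ltn_trans ltnn); rewrite ?srt // => x.
  apply/idP/idP => /mem [i <-]; apply/mem.
    by have [j <-] := (e (K i)).1 (ex_intro _ i erefl); exists j.
  by have [j <-] := (e (K' i)).2 (ex_intro _ i erefl); exists j.
apply/ffunP => i; apply: val_inj.
by move/eq_in_map: eqs; apply; rewrite mem_enum.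
Qed.

Lemma perm_ffun_inj :
  {in setX (plucker_index r N) [set: 'S_r] &, injective perm_ffun}.
Proof.
move=> [K s] [K' s']; rewrite !in_setX /= !inE !andbT => hK hK' /ffunP e.
have {}e i : K (s i) = K' (s' i) by have := e i; rewrite !ffunE.
have eK : K = K'.
  apply: plucker_index_uniq; rewrite ?inE // => x; split=> -[i <-].
    by exists (s' (s^-1%g i)); rewrite -e permKV.
  by exists (s (s'^-1%g i)); rewrite e permKV.
rewrite -eK in e *; congr (_, _); apply/permP => i.
by apply: (@plucker_index_inj K); rewrite ?inE.
Qed.

(** Sorting the values of an injection g yields an increasing K together with the permutation that
    relates it to g. *)
Lemma perm_ffun_image :
  perm_ffun @: setX (plucker_index r N) [set: 'S_r] =
  [set g : {ffun 'I_r -> 'I_N} | injectiveb g].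
Proof.
apply/setP => g; rewrite inE; apply/imsetP/injectiveP.
  move=> [[K s] + ->]; rewrite in_setX => /andP[hK _] i j.
  by rewrite !ffunE /= => /(plucker_index_inj hK)/perm_inj.
move=> ig.
pose t := [tuple g i | i < r].
pose t' := [tuple of sort (fun a b : 'I_N => (a <= b)%N) t].
have /tuple_permP [s es] : perm_eq t' t by rewrite perm_sort.
pose K : {ffun 'I_r -> 'I_N} := [ffun i => tnth t' i].
have eK i : K i = g (s i).
  rewrite ffunE; have /val_inj -> : val t' = val [tuple tnth t (s i0) | i0 < r] by [].
  by rewrite !tnth_mktuple.
exists (K, s^-1%g); last by apply/ffunP => i; rewrite ffunE /= eK permKV.
rewrite in_setX [in X in _ && X]inE andbT; apply/plucker_indexP => i j ij.
have iK : injective K by move=> a b; rewrite !eK => /ig /perm_inj.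
rewrite ltn_neqAle; apply/andP; split.
  by apply: contraTneq ij => /val_inj/iK ->; rewrite ltnn.
have srt : sorted (fun a b : 'I_N => (a <= b)%N) t'.
  by apply: sort_sorted => a b; exact: leq_total.
rewrite !ffunE !(tnth_nth (g i)).
apply: (sorted_leq_nth _ _ _ srt); rewrite ?inE ?size_tuple //; last exact: ltnW.
by move=> a b c; exact: leq_trans.
Qed.

End IncreasingMaps.

(** * Cauchy-Binet expansion in the presence of extra rows *)

Section CauchyBinet.
Variables (F : fieldType) (r q N : nat).
Implicit Types (M : 'M[F]_(r, N)) (A : 'M[F]_(N, r + q)) (C : 'M[F]_(q, r + q)).

(** Multilinearity in the top r rows only: each is a combination of rows of A, and g records which
    row of A is picked for each of them. *)
Lemma det_col_mx_mulE M A C :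
  \det (col_mx (M *m A) C) =
  \sum_(g : {ffun 'I_r -> 'I_N})
     (\prod_i M i (g i)) * \det (col_mx (rowsub g A) C).
Proof.
rewrite /determinant; under [RHS]eq_bigr do rewrite mulr_sumr.
rewrite exchange_big /=; apply: eq_bigr => s _.
rewrite big_split_ord /=.
under eq_bigr do rewrite col_mxEu mxE.
rewrite bigA_distr_bigA /= mulr_suml mulr_sumr; apply: eq_bigr => g _.
rewrite big_split_ord big_split /= [RHS]mulrCA; congr (_ * _).
rewrite -mulrA; congr (_ * (_ * _)).
  by apply: eq_bigr => i _; rewrite col_mxEu mxE.
by apply: eq_bigr => i _; rewrite !col_mxEd.
Qed.

Lemma det_col_rowsub0 (g : {ffun 'I_r -> 'I_N}) A C :
  ~~ injectiveb g -> \det (col_mx (rowsub g A) C) = 0.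
Proof.
move=> /injectivePn [i [j ij e]].
apply: (@determinant_alternate _ _ _ (lshift q i) (lshift q j)).
  by apply: contra_neq ij => /lshift_inj.
by move=> x; rewrite !col_mxEu !mxE e.
Qed.

Lemma det_col_row_perm (s : 'S_r) (X : 'M[F]_(r, r + q)) C :
  \det (col_mx (row_perm s X) C) = (-1) ^+ s * \det (col_mx X C).
Proof.
have -> : col_mx (row_perm s X) C = block_mx (perm_mx s) 0 0 1%:M *m col_mx X C.
  by rewrite mul_block_col !mul0mx addr0 add0r mul1mx row_permE.
by rewrite det_mulmx det_ublock det1 mulr1 det_perm.
Qed.

(* Laplace expansion and the Cauchy-Binet formula are both special cases. *)
Lemma det_col_mx_mul M A C :
  \det (col_mx (M *m A) C) =
  \sum_(K in plucker_index r N)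
     \det (colsub K M) * \det (col_mx (rowsub K A) C).
Proof.
rewrite det_col_mx_mulE (bigID (fun g : {ffun _} => injectiveb g)) /=.
rewrite [X in _ + X]big1 => [|g ng].
  rewrite addr0 -big_set /= -perm_ffun_image big_imset; last exact: perm_ffun_inj.
  transitivity (\sum_(K in plucker_index r N) \sum_(s : 'S_r)
      (\prod_i M i (perm_ffun (K, s) i)) *
      \det (col_mx (rowsub (perm_ffun (K, s)) A) C)).
    by rewrite pair_big /=; apply: eq_big => [[K s]|[K s] _] //=; rewrite in_setX in_setT.
  apply: eq_bigr => K hK.
  rewrite [\det (colsub K M)]/determinant mulr_suml; apply: eq_bigr => s _.
  have -> : rowsub (perm_ffun (K, s)) A = row_perm s (rowsub K A).
    by apply/matrixP => i j; rewrite !mxE ffunE.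
  rewrite det_col_row_perm mulrCA mulrA; congr (_ * _ * _).
  by apply: eq_bigr => i _; rewrite mxE ffunE.
by rewrite det_col_rowsub0 ?mulr0.
Qed.

End CauchyBinet.

(** * Determinants of bordered Gram matrices *)

Section BorderedGram.
Variables (F : fieldType) (r q N : nat).
Variables (Q : 'M[F]_N) (X : 'M[F]_(N, q)) (Y : 'M[F]_(q, N)).

Definition bordered (M : 'M[F]_(r, N)) : 'M[F]_(r + q) :=
  block_mx (M *m Q *m M^T) (M *m X) (Y *m M^T) 0.

Definition bordered_coef (K L : {ffun 'I_r -> 'I_N}) : F :=
  \det (block_mx (mxsub K L Q) (rowsub K X) (colsub L Y) 0).

Lemma rowsub_row_mx m n1 n2 p (f : 'I_p -> 'I_m) (A : 'M[F]_(m, n1)) (B : 'M[F]_(m, n2)) :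
  rowsub f (row_mx A B) = row_mx (rowsub f A) (rowsub f B).
Proof.
by apply/matrixP => i j; rewrite !mxE; case: splitP => x _; rewrite !mxE.
Qed.

(** The first r rows and the first r columns both factor through M, so [det_col_mx_mul] applies once
    directly and once after transposition. *)
Lemma det_bordered M :
  \det (bordered M) =
  \sum_(K in plucker_index r N) \sum_(L in plucker_index r N)
     bordered_coef K L * \det (colsub K M) * \det (colsub L M).
Proof.
rewrite /bordered block_mxEv -mulmxA -mul_mx_row det_col_mx_mul.
apply: eq_bigr => K _.
rewrite rowsub_row_mx -block_mxEv -[\det (block_mx _ _ _ _)]det_tr tr_block_mx trmx0.
have -> : rowsub K (Q *m M^T) = rowsub K Q *m M^T.
  by apply/matrixP => i j; rewrite !mxE; apply: eq_bigr => x _; rewrite !mxE.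
rewrite !trmx_mul !trmxK block_mxEv -mul_mx_row det_col_mx_mul mulr_sumr.
apply: eq_bigr => L _; rewrite rowsub_row_mx -block_mxEv.
rewrite -[RHS]mulrA [RHS]mulrC -mulrA; congr (_ * (_ * _)).
rewrite -[\det (block_mx _ _ _ _)]det_tr tr_block_mx trmx0 trmxK.
congr (\det (block_mx _ _ _ _)).
  by apply/matrixP => i j; rewrite !mxE.
by apply/matrixP => i j; rewrite !mxE.
Qed.

End BorderedGram.

(** * Families of vectors indexed by initial segments *)

Section Families.
Variables (F : fieldType) (V : vectType F).
Implicit Types (u : nat -> V) (S : {vspace V}).

Lemma mem_mkseq_span u k i : (i < k)%N -> u i \in <<mkseq u k>>%VS.
Proof. by move=> ik; rewrite memv_span ?map_f ?mem_iota. Qed.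

Lemma span_mkseqP u k x :
  reflect (exists c : 'I_k -> F, x = \sum_i c i *: u i) (x \in <<mkseq u k>>%VS).
Proof.
apply: (iffP idP) => [|[c ->]]; last first.
  by apply: memv_suml => i _; rewrite memvZ ?mem_mkseq_span.
have sz : size (mkseq u k) == k by rewrite size_mkseq.
move/(@coord_span _ _ _ (Tuple sz)) => ->.
exists (fun i => coord (Tuple sz) i x); apply: eq_bigr => i _.
by rewrite nth_mkseq.
Qed.

Lemma free_mkseqP u k :
  reflect (forall c : 'I_k -> F, \sum_i c i *: u i = 0 -> forall i, c i = 0)
          (free (mkseq u k)).
Proof.
have sz : size (mkseq u k) == k by rewrite size_mkseq.
apply: (iffP (@freeP _ _ _ (Tuple sz))) => h c e.
  by apply: h; rewrite -[RHS]e; apply: eq_bigr => i _; rewrite nth_mkseq.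
by apply: h; rewrite -[RHS]e; apply: eq_bigr => i _; rewrite nth_mkseq.
Qed.

Lemma mkseq_span_sub u k S :
  reflect (forall i, (i < k)%N -> u i \in S) (<<mkseq u k>> <= S)%VS.
Proof.
apply: (iffP span_subvP) => [h i ik|h x /mapP[i]].
  by apply: h; rewrite map_f ?mem_iota.
by rewrite mem_iota => /h ? ->.
Qed.

Lemma eq_mkseq_in (u v : nat -> V) k :
  (forall i, (i < k)%N -> u i = v i) -> mkseq u k = mkseq v k.
Proof. by move=> h; apply/eq_in_map => i; rewrite mem_iota => /h. Qed.

Lemma mkseq_nth_vbasis S : mkseq (nth 0 (vbasis S)) (\dim S) = vbasis S.
Proof. by rewrite -[X in mkseq _ X](size_tuple (vbasis S)) mkseq_nth. Qed.

Lemma free_mkseqS u k :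
  free (mkseq u k.+1) = (u k \notin <<mkseq u k>>%VS) && free (mkseq u k).
Proof. by rewrite mkseqS -free_cons; apply: perm_free; rewrite perm_rcons. Qed.

End Families.

(** * Transvections and Witt's extension theorem *)

Section Transvections.
Variables (F : fieldType) (V : vectType F) (B : {skew_symmetric V}).
Hypothesis Balt : forall u, B u u = 0.
Implicit Types (x y u v : V) (X : {vspace V}) (l : seq (V * F)).

Lemma skewC x y : B x y = - B y x.
Proof. by rewrite hermC expr1 mulN1r. Qed.

Lemma skew_suml I (r : seq I) (P : pred I) (f : I -> V) y :
  B (\sum_(i <- r | P i) f i) y = \sum_(i <- r | P i) B (f i) y.
Proof. exact: linear_sumlz. Qed.

Lemma skew_sumr I (r : seq I) (P : pred I) (f : I -> V) y :
  B y (\sum_(i <- r | P i) f i) = \sum_(i <- r | P i) B y (f i).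
Proof. exact: linear_sumr. Qed.

Lemma skewZl a x y : B (a *: x) y = a * B x y.
Proof. exact: linearZl_LR. Qed.

Lemma skewZr a x y : B x (a *: y) = a * B x y.
Proof. exact: linearZr. Qed.

Definition nondeg_on X := forall u, u \in X -> (forall v, v \in X -> B u v = 0) -> u = 0.

Lemma dual_family X k (u : nat -> V) : nondeg_on X ->
    (forall i, (i < k)%N -> u i \in X) -> free (mkseq u k) ->
  exists x : 'I_k -> V, (forall j, x j \in X) /\
    forall (i j : 'I_k), B (u i) (x j) = (i == j)%:R.
Proof.
move=> nX uX /free_mkseqP fu.
pose b := vbasis X.
pose M : 'M[F]_(k, \dim X) := \matrix_(i, j) B (u i) b`_j.
have /row_freeP [C MC] : row_free M.
  apply: inj_row_free => v vM.
  have v0 : \sum_i v 0 i *: u i = 0.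
    apply: nX => [|w wX]; first by apply: memv_suml => i _; rewrite memvZ ?uX.
    rewrite (coord_vbasis wX) skew_sumr big1 // => j _.
    rewrite skewZr skew_suml; have := congr1 (fun z : 'rV_ _ => z 0 j) vM.
    rewrite !mxE => e; rewrite -[RHS](mulr0 (coord b j w)) -[in RHS]e; congr (_ * _).
    by apply: eq_bigr => i _; rewrite skewZl mxE.
  by apply/rowP => i; rewrite mxE; apply: (fu (fun i => v 0 i)).
exists (fun j => \sum_i C i j *: b`_i); split=> [j|i j].
  by apply: memv_suml => i _; rewrite memvZ // vbasis_mem // mem_nth ?size_tuple.
rewrite skew_sumr; have := congr1 (fun z : 'M_ _ => z i j) MC.
rewrite !mxE => <-; apply: eq_bigr => x _; by rewrite skewZr mulrC mxE.
Qed.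

(* The parameter t deforms a product of transvections (t = 1) to the identity
   (t = 0). *)
Definition transv (t : F) (vc : V * F) x := x + (t * vc.2 * B x vc.1) *: vc.1.
Definition transvect l t x := foldr (transv t) x l.

Lemma transvect_cat l1 l2 t x :
  transvect (l1 ++ l2) t x = transvect l1 t (transvect l2 t x).
Proof. exact: foldr_cat. Qed.

Lemma transvect0 l x : transvect l 0 x = x.
Proof. by elim: l => //= vc l IH; rewrite /transv IH !mul0r scale0r addr0. Qed.

Lemma transvect_is_linear l t : linear (transvect l t).
Proof.
move=> a x y; elim: l => //= vc l ->; rewrite /transv.
set x' := transvect l t x; set y' := transvect l t y.
rewrite linearDl /= skewZl mulrDr scalerDl scalerDr scalerA.
by rewrite [t * _ * (a * _)]mulrCA addrACA.
Qed.

HB.instance Definition _ l t :=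
  GRing.isLinear.Build F V V *:%R (transvect l t) (transvect_is_linear l t).

(** The parameter only rescales the coefficient of each transvection, so the deformation consists of
    isometries at every t. *)
Lemma transvect_isom l t x y : B (transvect l t x) (transvect l t y) = B x y.
Proof.
elim: l => //= -[v c] l <-; rewrite /transv /=.
set x' := transvect l t x; set y' := transvect l t y.
rewrite linearDl /= !linearDr /= !skewZl !skewZr Balt !mulr0 addr0.
by rewrite [B v y']skewC; ring.
Qed.

Lemma transvect_inj X l t x : nondeg_on X -> x \in X -> transvect l t x = 0 -> x = 0.
Proof.
move=> nX xX e; apply: nX => // v _.
by rewrite -(transvect_isom l t) e linear0l.
Qed.

Lemma transvect_stable X l t x :
  (forall vc, vc \in l -> vc.1 \in X) -> x \in X -> transvect l t x \in X.
Proof.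
elim: l => //= vc l IH h xX; rewrite /transv memvD //.
  by apply: IH => // v vl; apply: h; rewrite inE vl orbT.
by rewrite memvZ // h ?mem_head.
Qed.

Lemma transvect_fix l t x : (forall vc, vc \in l -> B x vc.1 = 0) -> transvect l t x = x.
Proof.
elim: l => //= vc l IH h; rewrite IH => [|v vl]; last by apply: h; rewrite inE vl orbT.
by rewrite /transv h ?mem_head // mulr0 scale0r addr0.
Qed.

(** The transvection along y - x with coefficient 1 / B x y: as B x x = 0, it adds exactly y - x to
    x, and it fixes everything orthogonal to y - x. *)
Lemma transv_move X x y : x \in X -> y \in X -> B x y != 0 ->
  exists vc : V * F, [/\ vc.1 \in X, transv 1 vc x = y &
    forall z, B z x = B z y -> transv 1 vc z = z].
Proof.
move=> xX yX nz; exists (y - x, (B x y)^-1); split=> /=; first by rewrite memvB.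
  by rewrite /transv /= linearBr /= Balt subr0 mul1r mulVf // scale1r addrC subrK.
by move=> z e; rewrite /transv /= linearBr /= e subrr mulr0 scale0r addr0.
Qed.

(** The vector z is the last member of a family dual to u extended by x. *)
Lemma separate X k (u : nat -> V) x : nondeg_on X ->
    (forall i, (i < k)%N -> u i \in X) -> x \in X -> free (mkseq u k) ->
    x \notin <<mkseq u k>>%VS ->
  exists z, [/\ z \in X, B x z != 0 & forall i, (i < k)%N -> B (u i) z = 0].
Proof.
move=> nX uX xX fu nx.
pose u' i := if (i < k)%N then u i else x.
have e : mkseq u' k = mkseq u k by apply: eq_mkseq_in => i ik; rewrite /u' ik.
have [||w [wX wd]] := @dual_family X k.+1 u' nX.
- by move=> i _; rewrite /u'; case: ifP => // /uX.
- by rewrite free_mkseqS e fu {1}/u' ltnn nx.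
exists (w ord_max); split=> //.
  have := wd ord_max ord_max; rewrite /u' /= ltnn eqxx => ->; exact: oner_neq0.
move=> i ik; have := wd (widen_ord (leqnSn k) (Ordinal ik)) ord_max.
by rewrite /u' /= ik => ->; rewrite -val_eqE /= (ltn_eqF ik).
Qed.

(* The transvection along y - x works when B x y <> 0; otherwise pass through a
   vector x + z that pairs nontrivially with both x and y. *)
Lemma move_fixing X k (u : nat -> V) x y : nondeg_on X ->
    (forall i, (i < k)%N -> u i \in X) -> x \in X -> y \in X -> free (mkseq u k) ->
    x \notin <<mkseq u k>>%VS -> y \notin <<mkseq u k>>%VS ->
    (forall i, (i < k)%N -> B (u i) x = B (u i) y) ->
  exists l, [/\ forall vc, vc \in l -> vc.1 \in X, transvect l 1 x = y &
    forall i, (i < k)%N -> transvect l 1 (u i) = u i].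
Proof.
move=> nX uX xX yX fu nx ny exy.
have [e|nz] := eqVneq (B x y) 0; last first.
  have [vc [vX vx vfix]] := transv_move xX yX nz.
  exists [:: vc]; split=> // [v|i ik]; first by rewrite inE => /eqP->.
  by rewrite /= vfix ?exy.
have [z [zX zx zy zu]] : exists z, [/\ z \in X, B x z != 0, B y z != 0 &
    forall i, (i < k)%N -> B (u i) z = 0].
  have [z1 [z1X z1x z1u]] := separate nX uX xX fu nx.
  have [z2 [z2X z2y z2u]] := separate nX uX yX fu ny.
  have [e1|?] := eqVneq (B y z1) 0; last by exists z1.
  have [e2|?] := eqVneq (B x z2) 0; last by exists z2.
  (* Here z1 pairs nontrivially with x only and z2 with y only, so their sum pairs nontrivially with
     both. *)
  exists (z1 + z2); split; rewrite ?memvD ?linearDr /= ?e1 ?e2 ?addr0 ?add0r //.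
  by move=> i ik; rewrite linearDr /= z1u ?z2u ?addr0.
have wX : x + z \in X by rewrite memvD.
have n1 : B x (x + z) != 0 by rewrite linearDr /= Balt add0r.
have n2 : B (x + z) y != 0.
  by rewrite linearDl /= e add0r skewC oppr_eq0.
have [v1 [v1X v1x v1f]] := transv_move xX wX n1.
have [v2 [v2X v2x v2f]] := transv_move wX yX n2.
exists [:: v2; v1]; split=> [v||i ik] /=.
- by rewrite !inE => /orP[]/eqP->.
- by rewrite v1x v2x.
have ew : B (u i) x = B (u i) (x + z) by rewrite linearDr /= zu ?addr0.
by rewrite v1f // v2f // -ew exy.
Qed.

(* Witt's extension theorem, the isometry being a product of transvections. *)
Lemma witt X k (u w : nat -> V) : nondeg_on X ->
    (forall i, (i < k)%N -> u i \in X) -> (forall i, (i < k)%N -> w i \in X) ->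
    free (mkseq u k) -> free (mkseq w k) ->
    (forall i j, (i < k)%N -> (j < k)%N -> B (u i) (u j) = B (w i) (w j)) ->
  exists l, (forall vc, vc \in l -> vc.1 \in X) /\
    forall i, (i < k)%N -> transvect l 1 (u i) = w i.
Proof.
move=> nX; elim: k => [|k IH] uX wX fu fw g; first by exists [::].
move: (fu) (fw); rewrite !free_mkseqS => /andP[nu fu'] /andP[nw fw'].
have [|||l [lX lu]] := IH _ _ fu' fw'.
- by move=> i ik; apply: uX; rewrite ltnS ltnW.
- by move=> i ik; apply: wX; rewrite ltnS ltnW.
- by move=> i j ik jk; apply: g; rewrite ltnS ltnW.
have [|||||||l' [l'X l'x l'f]] := @move_fixing X k w (transvect l 1 (u k)) (w k) nX.
- by move=> i ik; apply: wX; rewrite ltnS ltnW.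
- by apply: transvect_stable => //; apply: uX.
- exact: wX.
- by [].
- apply: contra nu => /span_mkseqP [c ec]; apply/span_mkseqP; exists c.
  apply/eqP; rewrite -subr_eq0; apply/eqP; apply: (@transvect_inj X l 1) => //.
    rewrite memvB ?uX //; apply: memv_suml => i _.
    by rewrite memvZ ?uX // ltnS ltnW.
  rewrite linearB /= linear_sum /= ec; apply/eqP; rewrite subr_eq0; apply/eqP.
  by apply: eq_bigr => i _; rewrite linearZ /= lu.
- by [].
- by move=> i ik; rewrite -lu // transvect_isom g ?lu // ltnS ltnW.
exists (l' ++ l); split=> [vc|i]; first by rewrite mem_cat => /orP[/l'X|/lX].
rewrite ltnS transvect_cat leq_eqVlt => /predU1P[->//|ik].
by rewrite lu // l'f.
Qed.

End Transvections.

(** * Normal form of an alternating form *)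

Section StandardGram.
Variables (F : fieldType) (V : vectType F) (B : {skew_symmetric V}).
Hypothesis Balt : forall u, B u u = 0.
Implicit Types (X : {vspace V}) (e : nat -> V).

(* The Gram matrix of k hyperbolic pairs (0,1), (2,3), ..., bordered by zeros. *)
Definition std_gram (k i j : nat) : F :=
  ((i./2 == j./2) && (i./2 < k))%N%:R * ((odd j)%:R - (odd i)%:R).

Lemma std_gram_eq0 k i j : (k.*2 <= i)%N || (k.*2 <= j)%N -> std_gram k i j = 0.
Proof.
rewrite /std_gram => h; have -> : (i./2 == j./2) && (i./2 < k)%N = false by lia.
by rewrite mul0r.
Qed.

Lemma std_gramSS k i j : std_gram k.+1 i.+2 j.+2 = std_gram k i j.
Proof. by rewrite /std_gram /= !negbK eqSS ltnS. Qed.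

(** The two indices of a hyperbolic pair have opposite parity. Alternating signs therefore produce
    the opposite Gram matrix, which is how the components in U and W will cancel in an isotropic
    subspace. *)
Lemma std_gram_weight k i j :
  (-1) ^+ odd i * (-1) ^+ odd j * std_gram k i j = - std_gram k i j.
Proof. by rewrite /std_gram; case: odd; case: odd; rewrite /=; ring. Qed.

Lemma std_gram_coef k e (c : 'I_k.*2 -> F) :
    (forall i j, (i < k.*2)%N -> (j < k.*2)%N -> B (e i) (e j) = std_gram k i j) ->
    (forall j, (j < k.*2)%N -> B (\sum_i c i *: e i) (e j) = 0) ->
  forall i, c i = 0.
Proof.
move=> g h i; have ik := ltn_ord i.
(* The other index of the hyperbolic pair containing i; pairing with it isolates the coefficient c i
   up to sign. *)
pose i' := (i./2.*2 + ~~ odd i)%N.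
have i'k : (i' < k.*2)%N by rewrite /i'; lia.
have := h _ i'k; rewrite skew_suml (bigD1 i) //= big1 => [|a ai].
  rewrite addr0 skewZl g // /std_gram.
  have -> : (i./2 == i'./2) && (i./2 < k)%N by rewrite /i'; lia.
  have -> : odd i' = ~~ odd i by rewrite /i'; lia.
  rewrite mul1r; case: odd => /= /eqP;
    by rewrite ?subr0 ?sub0r ?mulrN ?mulr1 ?oppr_eq0 => /eqP.
rewrite skewZl g ?ltn_ord // /std_gram.
have [ea|] := boolP ((a./2 == i'./2) && (a./2 < k))%N; last by rewrite mul0r mulr0.
have -> : odd a = odd i'.
  have : nat_of_ord a != i by [].
  by move: ea; rewrite /i'; lia.
by rewrite subrr !mulr0.
Qed.

Lemma std_gram_free k e :
    (forall i j, (i < k.*2)%N -> (j < k.*2)%N -> B (e i) (e j) = std_gram k i j) ->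
  free (mkseq e k.*2).
Proof.
move=> g; apply/free_mkseqP => c ec; apply: (std_gram_coef g) => j _.
by rewrite ec linear0l.
Qed.

Lemma std_gram_cap_Rad k e X :
    (forall i j, (i < k.*2)%N -> (j < k.*2)%N -> B (e i) (e j) = std_gram k i j) ->
    (forall i, (i < k.*2)%N -> e i \in X) ->
  (<<mkseq e k.*2>> :&: Rad B X = 0)%VS.
Proof.
move=> g eX; apply/eqP; rewrite -subv0; apply/subvP => x.
rewrite !memv_cap memv0 => /and3P[/span_mkseqP[c ->] _ /mem_orthovP xO].
by rewrite big1 // => i _; rewrite (std_gram_coef g) ?scale0r // => j jk; rewrite xO ?eX.
Qed.

(** Induction on the dimension: unless X is totally isotropic, a hyperbolic pair x, f splits off and
    its orthogonal complement X' in X is smaller. *)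
Lemma standard_form X : exists k e,
  [/\ forall i, (i < k.*2)%N -> e i \in X,
      forall i j, (i < k.*2)%N -> (j < k.*2)%N -> B (e i) (e j) = std_gram k i j &
      (X <= <<mkseq e k.*2>> + Rad B X)%VS].
Proof.
have [d] := ubnP (\dim X); elim: d X => // d IH X; rewrite ltnS => dX.
have [XX|] := boolP (X <= orthov B X)%VS.
  exists 0%N, (fun=> 0); split=> //; rewrite span_nil add0v.
  by rewrite subv_cap subvv.
case/subvPn => x xX /mem_orthovPn [y yX nxy].
have [f [fX xf]] : exists f, f \in X /\ B x f = 1.
  by exists ((B x y)^-1 *: y); rewrite memvZ // skewZr mulVf.
have fx : B f x = -1 by rewrite (skewC B) xf.
pose X' := (X :&: orthov B <<[:: x; f]>>)%VS.
have inX' z : z \in X -> B z x = 0 -> B z f = 0 -> z \in X'.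
  move=> zX zx zf; rewrite memv_cap zX; apply/mem_orthovP => w.
  rewrite span_cons span_seq1 => /memv_addP [_ /vlineP[a ->] [_ /vlineP[b ->] ->]].
  by rewrite linearDr /= !skewZr zx zf !mulr0 addr0.
have X'x z : z \in X' -> [/\ z \in X, B z x = 0 & B z f = 0].
  rewrite memv_cap => /andP[zX /mem_orthovP h].
  by split=> //; apply: h; rewrite memv_span // !inE eqxx ?orbT.
have lt : (\dim X' < d)%N.
  apply: leq_trans dX; rewrite ltn_neqAle dimvS ?capvSl // andbT.
  apply/negP; rewrite (dimv_leqif_eq (capvSl _ _)) => /eqP e.
  have : x \in X' by rewrite /X' e.
  by case/X'x => _ _ /eqP; rewrite xf oner_eq0.
have [k [e [eX' g sub]]] := IH _ lt.
exists k.+1, (fun i => if i is i'.+1 then if i' is i''.+1 then e i'' else f else x).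
split.
- by case=> [|[|i]] //; rewrite doubleS !ltnS => /eX'/X'x[].
- case=> [|[|i]] [|[|j]]; rewrite ?doubleS ?ltnS // => hi hj.
  + by rewrite Balt /std_gram subrr mulr0.
  + by rewrite xf /std_gram /= subr0 mulr1.
  + by rewrite (skewC B); case/X'x: (eX' _ hj) => _ -> _; rewrite oppr0 /std_gram /= mul0r.
  + by rewrite fx /std_gram /= sub0r mul1r.
  + by rewrite Balt /std_gram subrr mulr0.
  + by rewrite (skewC B); case/X'x: (eX' _ hj) => _ _ ->; rewrite oppr0 /std_gram /= mul0r.
  + by case/X'x: (eX' _ hi) => _ -> _; rewrite /std_gram /= mul0r.
  + by case/X'x: (eX' _ hi) => _ _ ->; rewrite /std_gram /= mul0r.
  + by rewrite std_gramSS g.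
have -> : mkseq (fun i => if i is i'.+1 then if i' is i''.+1 then e i'' else f else x)
   (k.+1).*2 = [:: x, f & mkseq e k.*2].
  by rewrite doubleS /mkseq /= -[2%N]/(2 + 0)%N iotaDl -map_comp.
(* Orthogonal projection onto the hyperbolic plane of x and f. *)
have dec z : z \in X -> exists a b z', z' \in X' /\ z = (a *: x + b *: f) + z'.
  move=> zX; exists (B z f), (- B z x), (z - B z f *: x + B z x *: f); split.
    apply: inX'; rewrite ?memvD ?memvN ?memvZ // linearDl linearBl /= !skewZl.
      by rewrite Balt fx; ring.
    by rewrite Balt xf; ring.
  by rewrite scaleNr addrACA addNr addr0 addrC subrK.
apply/subvP => z zX; have [a [b [z' [z'X ->]]]] := dec z zX.
rewrite !span_cons addvA -addvA; apply: memv_add.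
  by apply: memv_add; rewrite memvZ ?memv_line.
apply: (subvP (addvS (subvv _) _)) (subvP sub _ z'X).
(* The radical of X' lies in that of X, because X is spanned by X' and by x, f, which are orthogonal
   to X'. *)
apply/subvP => w; rewrite memv_cap => /andP[wX' /mem_orthovP wO].
have [wX wx wf] := X'x _ wX'.
rewrite memv_cap wX; apply/mem_orthovP => v /dec [a' [b' [v' [v'X ->]]]].
by rewrite !linearDr /= !skewZr wx wf !mulr0 !add0r wO.
Qed.

Lemma standard_form_Rad X : exists k e,
  [/\ forall i, (i < k.*2)%N -> e i \in X,
      forall i j, (i < k.*2)%N -> (j < k.*2)%N -> B (e i) (e j) = std_gram k i j,
      (<<mkseq e k.*2>> + Rad B X = X)%VS &
      \dim X = (k.*2 + \dim (Rad B X))%N].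
Proof.
have [k [e [eX g sub]]] := standard_form X; exists k, e.
have eq : (<<mkseq e k.*2>> + Rad B X = X)%VS.
  apply/eqP; rewrite eqEsubv sub andbT subv_add capvSl andbT.
  exact/mkseq_span_sub.
split=> //; rewrite -[in LHS]eq dimv_disjoint_sum; last exact: std_gram_cap_Rad.
by have := std_gram_free g; rewrite /free size_mkseq => /eqP ->.
Qed.

End StandardGram.

(** * Plücker coordinates under a change of basis *)

Section PluckerCoordinates.
Variables (F : fieldType) (V : vectType F).
Implicit Types (S : {vspace V}) (s t : nat -> V).

Definition coord_mx r s : 'M[F]_(r, \dim {:V}) :=
  \matrix_(i, j) coord (vbasis fullv) j (s i).

Lemma pluckerE r S (k : 'I_(plucker_dim V r)) :
  plucker S k = \det (colsub (enum_val k) (coord_mx r (nth 0 (vbasis S)))).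
Proof. by congr (\det _); apply/matrixP => i j; rewrite !mxE. Qed.

Lemma plucker_basis r s : free (mkseq s r) -> exists2 c : F, c != 0 &
  forall k : 'I_(plucker_dim V r),
    \det (colsub (enum_val k) (coord_mx r s)) = c * plucker <<mkseq s r>> k.
Proof.
move=> fs; set S := <<_>>%VS.
have dS : \dim S = r by move: fs; rewrite /free size_mkseq => /eqP.
pose P : 'M[F]_(r, \dim S) := \matrix_(i, j) coord (vbasis S) j (s i).
have sP (i : 'I_r) : s i = \sum_j P i j *: (vbasis S)`_j.
  rewrite {1}(coord_vbasis (mem_mkseq_span s (ltn_ord i))).
  by apply: eq_bigr => j _; rewrite mxE.
clearbody P; have P0 (v : 'rV[F]_r) : v *m P = 0 -> v = 0.
  move=> vP; apply/rowP => i; rewrite mxE; move/free_mkseqP: fs => /(_ (v 0)) fs.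
  apply: fs.
  transitivity (\sum_j (v *m P) 0 j *: (vbasis S)`_j); last first.
    by rewrite vP big1 // => j _; rewrite mxE scale0r.
  under eq_bigr => k _ do rewrite sP scaler_sumr.
  rewrite exchange_big; apply: eq_bigr => j _ /=; rewrite [in RHS]mxE scaler_suml.
  by apply: eq_bigr => k _; rewrite scalerA.
have Ps : coord_mx r s = P *m coord_mx (\dim S) (nth 0 (vbasis S)).
  apply/matrixP => i k; rewrite [LHS]mxE [RHS]mxE sP linear_sum; apply: eq_bigr => j _.
  by rewrite linearZ; congr (_ * _); rewrite mxE.
suff [c c0 hc] : exists2 c : F, c != 0 & forall K : {ffun 'I_r -> 'I_(\dim {:V})},
    \det (colsub K (coord_mx r s)) = c * \det (colsub K (coord_mx r (nth 0 (vbasis S)))).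
  by exists c => // k; rewrite hc pluckerE.
(* Only once [\dim S] is rewritten to r is the change-of-basis matrix P square; its determinant is
   the factor c. *)
clear sP; move: P P0 Ps; move: (nth 0 (vbasis S)); rewrite dS => x P P0 ->.
exists (\det P); first by apply/det0P => -[v /eqP v0 /P0].
by move=> K; rewrite -det_mulmx mulmx_colsub.
Qed.

Lemma homog_meval_scale n (p : {mpoly F[n]}) d c (v w : 'I_n -> F) :
  p \is d.-homog -> (forall i, v i = c * w i) -> p.@[v] = c ^+ d * p.@[w].
Proof.
move=> /dhomogP hp e; rewrite !mevalE mulr_sumr.
rewrite big_seq [RHS]big_seq; apply: eq_bigr => m mp.
rewrite mulrCA; congr (_ * _); under eq_bigr => i _ do rewrite e exprMn.
rewrite big_split /= prodrXr; congr (c ^+ _ * _).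
by rewrite -(hp _ mp) /= mdegE.
Qed.

End PluckerCoordinates.

(** * Polynomial functions on an infinite field *)

Section PolynomialFunctions.
Variable F : fieldType.
Implicit Types (f g : F -> F).

Definition polyfun f := exists q : {poly F}, forall t, f t = q.[t].

Lemma polyfun_const c : polyfun (fun=> c).
Proof. by exists c%:P => t; rewrite hornerC. Qed.

Lemma polyfun_id : polyfun id.
Proof. by exists 'X => t; rewrite hornerX. Qed.

Lemma polyfunD f g : polyfun f -> polyfun g -> polyfun (fun t => f t + g t).
Proof. by case=> p hp [q hq]; exists (p + q) => t; rewrite hornerD hp hq. Qed.

Lemma polyfunM f g : polyfun f -> polyfun g -> polyfun (fun t => f t * g t).
Proof. by case=> p hp [q hq]; exists (p * q) => t; rewrite hornerM hp hq. Qed.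

Lemma polyfun_sum I (r : seq I) (P : pred I) (f : I -> F -> F) :
  (forall i, P i -> polyfun (f i)) -> polyfun (fun t => \sum_(i <- r | P i) f i t).
Proof.
move=> h; elim: r => [|i r [q hq]].
  by exists 0 => t; rewrite big_nil horner0.
have [Pi|nPi] := boolP (P i).
  by have [p hp] := h i Pi; exists (p + q) => t; rewrite big_cons Pi hornerD hp hq.
by exists q => t; rewrite big_cons (negPf nPi).
Qed.

Lemma polyfun_prod I (r : seq I) (P : pred I) (f : I -> F -> F) :
  (forall i, P i -> polyfun (f i)) -> polyfun (fun t => \prod_(i <- r | P i) f i t).
Proof.
move=> h; elim: r => [|i r [q hq]].
  by exists 1 => t; rewrite big_nil hornerE.
have [Pi|nPi] := boolP (P i).
  by have [p hp] := h i Pi; exists (p * q) => t; rewrite big_cons Pi hornerM hp hq.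
by exists q => t; rewrite big_cons (negPf nPi).
Qed.

Lemma polyfun_exp f n : polyfun f -> polyfun (fun t => f t ^+ n).
Proof. by case=> p hp; exists (p ^+ n) => t; rewrite horner_exp hp. Qed.

Lemma polyfun_det n (M : F -> 'M[F]_n) :
  (forall i j, polyfun (fun t => M t i j)) -> polyfun (fun t => \det (M t)).
Proof.
move=> h; apply: polyfun_sum => s _; apply: polyfunM; first exact: polyfun_const.
by apply: polyfun_prod.
Qed.

Lemma polyfun_meval n (p : {mpoly F[n]}) (v : F -> 'I_n -> F) :
  (forall i, polyfun (fun t => v t i)) -> polyfun (fun t => p.@[v t]).
Proof.
move=> h; have [q hq] : polyfun (fun t => \sum_(m <- msupp p) p@_m * \prod_i v t i ^+ m i).
  apply: polyfun_sum => m _; apply: polyfunM; first exact: polyfun_const.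
  by apply: polyfun_prod => i _; apply: polyfun_exp.
by exists q => t; rewrite mevalE.
Qed.

Hypothesis F_infinite : forall s : seq F, exists x, x \notin s.

Lemma poly_nonroot (q : {poly F}) : q != 0 -> exists t, q.[t] != 0.
Proof.
move=> q0; have [s [us ss]] : exists s : seq F, uniq s /\ size s = size q.
  elim: (size q) => [|n [s [us <-]]]; first by exists [::].
  by have [x xs] := F_infinite s; exists (x :: s); rewrite /= xs us.
have [/(max_poly_roots q0)/(_ us)|/allPn[t _ ht]] := boolP (all (root q) s).
  by rewrite ss ltnn.
by exists t.
Qed.

End PolynomialFunctions.

(** * Nonempty open sets of the isotropic Grassmannian meet *)

Section OpenSetsMeet.
Variables (F : fieldType) (V : vectType F) (B : {skew_symmetric V}).
Hypothesis F_infinite : forall s : seq F, exists x, x \notin s.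
Hypothesis Balt : forall u, B u u = 0.
Hypothesis Bnondeg : nondeg_on B fullv.
Implicit Types (S : {vspace V}) (X O : {vspace V} -> Prop).

(** Each transvection contributes one factor t; its pairing with v is expanded in coordinates, to
    which the induction hypothesis applies. *)
Lemma polyfun_transvect l x j :
  polyfun (fun t => coord (vbasis fullv) j (transvect B l t x)).
Proof.
elim: l j => [|[v c] l IH] j /=; first exact: polyfun_const.
have [q hq] : polyfun (fun t => coord (vbasis fullv) j (transvect B l t x)
    + t * c * (\sum_i coord (vbasis fullv) i (transvect B l t x) * B (vbasis fullv)`_i v)
      * coord (vbasis fullv) j v).
  apply: polyfunD => //; apply: polyfunM; last exact: polyfun_const.
  apply: polyfunM; first by apply: polyfunM (polyfun_id _) (polyfun_const _).
  by apply: polyfun_sum => i _; apply: polyfunM (polyfun_const _).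
exists q => t; rewrite -hq /transv linearD linearZ /=; congr (_ + _ * _ * _).
rewrite [in LHS](coord_vbasis (memvf (transvect B l t x))) skew_suml.
by apply: eq_bigr => i _; rewrite skewZl.
Qed.

(** Among the equations of the complement one does not vanish at S0; its nonvanishing locus is a
    principal open neighbourhood inside X. Classical logic extracts it. *)
Lemma zariski_open_witness r X S0 : zariski_open B r X -> X S0 ->
  exists p d, [/\ p \is d.-homog, p.@[plucker (r := r) S0] != 0 &
    forall S, isoGr B r S -> p.@[plucker (r := r) S] != 0 -> X S].
Proof.
case=> Xiso [I [Ihom hI]] XS0.
have [p [Ip p0]] : exists p, I p /\ p.@[plucker (r := r) S0] <> 0.
  apply: NNPP => h; have : isoGr B r S0 /\ ~ X S0; last by case.
  apply/hI; split=> [|p Ip]; first exact: Xiso.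
  by apply: NNPP => p0; apply: h; exists p.
have [d hd] := Ihom p Ip; exists p, d; split=> //; first exact/eqP.
move=> S iS /eqP pS; apply: NNPP => nX; apply: pS.
by have [_] : isoGr B r S /\ (forall p, I p -> p.@[plucker (r := r) S] = 0);
  [apply/hI|apply].
Qed.

(* A product of transvections takes S0 to S1; deforming it to the identity gives a
   curve from S0 to S1 along which the Pluecker coordinates are polynomials. *)
Lemma open_meet r X O S0 S1 :
  zariski_open B r X -> zariski_open B r O -> X S0 -> O S1 -> exists S, X S /\ O S.
Proof.
move=> oX oO XS0 OS1.
have basis S : isoGr B r S -> exists s : nat -> V, [/\ S = <<mkseq s r>>%VS,
    free (mkseq s r) & forall i j, (i < r)%N -> (j < r)%N -> B (s i) (s j) = 0].
  case/andP => /eqP dS /orthovP iS; exists (nth 0 (vbasis S)).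
  rewrite -dS mkseq_nth_vbasis; split; first by rewrite (span_basis (vbasisP S)).
    exact: basis_free (vbasisP S).
  by move=> i j hi hj; apply: iS; rewrite vbasis_mem // mem_nth // size_tuple.
have [s0 [e0 f0 g0]] := basis _ (oX.1 _ XS0).
have [s1 [e1 f1 g1]] := basis _ (oO.1 _ OS1).
have [i _|i _|i j ir jr|l [_ hl]] := witt Balt Bnondeg _ _ f0 f1.
- exact: memvf.
- exact: memvf.
- by rewrite g0 ?g1.
pose s t i := transvect B l t (s0 i).
have fs t : free (mkseq (s t) r).
  apply/free_mkseqP => c e i; move/free_mkseqP: f0; apply.
  apply: (transvect_inj Balt (l := l) (t := t) Bnondeg (memvf _)).
  by rewrite linear_sum -[RHS]e; apply: eq_bigr => j _; rewrite linearZ.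
have iS t : isoGr B r <<mkseq (s t) r>>.
  apply/andP; split; first by have := fs t; rewrite /free size_mkseq.
  apply/orthovP => _ _ /span_mkseqP[a ->] /span_mkseqP[b ->].
  rewrite skew_suml big1 // => i _; rewrite skew_sumr big1 // => j _.
  by rewrite skewZl skewZr transvect_isom // g0 // !mulr0.
have E0 : <<mkseq (s 0%R) r>>%VS = S0.
  by rewrite e0; congr <<_>>%VS; apply: eq_mkseq_in => i _; rewrite /s transvect0.
have E1 : <<mkseq (s 1%R) r>>%VS = S1.
  by rewrite e1; congr <<_>>%VS; apply: eq_mkseq_in => i ir; rewrite /s hl.
have curve Y : zariski_open B r Y -> forall t0, Y <<mkseq (s t0) r>>%VS ->
    exists q : {poly F}, q.[t0] != 0 /\ forall t, q.[t] != 0 -> Y <<mkseq (s t) r>>%VS.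
  move=> oY t0 Yt0; have [p [d [hp p0 hY]]] := zariski_open_witness oY Yt0.
  have [q hq] : polyfun (fun t =>
      p.@[fun k : 'I_(plucker_dim V r) => \det (colsub (enum_val k) (coord_mx r (s t)))]).
    apply: polyfun_meval => k; apply: polyfun_det => i j.
    have [q hq] := polyfun_transvect l (s0 i) ((enum_val k) j).
    by exists q => t; rewrite !mxE hq.
  (* The basis [vbasis] of the span need not vary polynomially with t, so q is built on the moving
     basis [s t]; homogeneity of p makes the two values differ by a nonzero factor. *)
  have pq t : (q.[t] != 0) = (p.@[plucker (r := r) <<mkseq (s t) r>>] != 0).
    have [c c0 hc] := plucker_basis (fs t).
    by rewrite -hq (homog_meval_scale hp hc) mulf_eq0 negb_or expf_neq0.
  by exists q; rewrite pq; split=> // t; rewrite pq; apply: hY.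
have [qX [qX0 hX]] := curve X oX 0 ltac:(by rewrite E0).
have [qO [qO1 hO]] := curve O oO 1 ltac:(by rewrite E1).
have qq : qX * qO != 0.
  rewrite mulf_neq0 //; first by apply: contra_neq qX0 => ->; rewrite horner0.
  by apply: contra_neq qO1 => ->; rewrite horner0.
have [t] := poly_nonroot F_infinite qq.
rewrite hornerM mulf_eq0 negb_or => /andP[/hX ? /hO ?].
by exists <<mkseq (s t) r>>%VS.
Qed.

End OpenSetsMeet.

(** * Projections onto the two orthogonal summands *)

Section Decomposition.
Variables (F : fieldType) (V : vectType F) (B : {skew_symmetric V}).
Hypothesis Balt : forall u, B u u = 0.
Hypothesis Bnondeg : nondeg_on B fullv.
Variables (U W : {vspace V}).
Hypotheses (V_sum : (U + W)%VS = fullv) (UW0 : (U :&: W)%VS = 0%VS).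
Hypothesis UperpW : (U <= orthov B W)%VS.
Implicit Types (S T X : {vspace V}) (x y u v w : V) (g : 'End(V)).

Local Notation pU := (daddv_pi U W).
Local Notation pW := (daddv_pi W U).

Lemma proj_add x : pU x + pW x = x.
Proof. by apply: daddv_pi_add; rewrite // V_sum memvf. Qed.

Lemma projU_id u : u \in U -> pU u = u.
Proof. exact: daddv_pi_id. Qed.

Lemma projW_id w : w \in W -> pW w = w.
Proof. by apply: daddv_pi_id; rewrite capvC. Qed.

Lemma projU_eq0 x : (pU x == 0) = (x \in W).
Proof.
apply/eqP/idP => [e|xW]; first by rewrite -(proj_add x) e add0r memv_pi.
by have := proj_add x; rewrite projW_id // -[RHS]add0r => /addIr.
Qed.

Lemma projW_eq0 x : (pW x == 0) = (x \in U).
Proof.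
apply/eqP/idP => [e|xU]; first by rewrite -(proj_add x) e addr0 memv_pi.
by have := proj_add x; rewrite projU_id // -[RHS]addr0 => /addrI.
Qed.

Lemma skewUW u w : u \in U -> w \in W -> B u w = 0.
Proof. by move=> uU wW; move/orthovP: UperpW; apply. Qed.

Lemma skewWU w u : w \in W -> u \in U -> B w u = 0.
Proof. by move=> wW uU; rewrite (skewC B) skewUW ?oppr0. Qed.

Lemma skewU x u : u \in U -> B x u = B (pU x) u.
Proof.
by move=> uU; rewrite -{1}(proj_add x) linearDl /= [B (pW x) u]skewWU ?memv_pi ?addr0 //.
Qed.

Lemma skewW x w : w \in W -> B x w = B (pW x) w.
Proof.
by move=> wW; rewrite -{1}(proj_add x) linearDl /= skewUW ?memv_pi ?add0r //.
Qed.

Lemma skew_proj x y : B x y = B (pU x) (pU y) + B (pW x) (pW y).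
Proof.
by rewrite -{1}(proj_add y) linearDr /= [B x (pU y)]skewU ?memv_pi //
  [B x (pW y)]skewW ?memv_pi.
Qed.

Lemma nondegU : nondeg_on B U.
Proof.
move=> u uU h; apply: Bnondeg => [|v _]; first exact: memvf.
rewrite -(proj_add v) linearDr /= h ?memv_pi // skewUW ?memv_pi ?addr0 //.
Qed.

Lemma nondegW : nondeg_on B W.
Proof.
move=> u uU h; apply: Bnondeg => [|v _]; first exact: memvf.
by rewrite -(proj_add v) linearDr /= skewWU ?memv_pi // add0r h ?memv_pi.
Qed.

Lemma PU_img S : PU U W S = (pU @: S)%VS.
Proof.
apply/vspaceP => u; rewrite /PU memv_cap; apply/andP/memv_imgP.
  case=> /memv_addP[s sS [w wW ->]] h; exists s => //.
  rewrite -(projU_id h) linearD /=.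
  have /eqP -> : pU w == 0 by rewrite projU_eq0.
  by rewrite addr0.
case=> s sS ->; split; last exact: memv_pi.
have -> : pU s = s - pW s by rewrite -{2}(proj_add s) addrK.
by rewrite memvB ?(subvP (addvSl S W) _ sS) // (subvP (addvSr S W)) ?memv_pi.
Qed.

(** Rank-nullity for p_U restricted to S. *)
Lemma dim_PU S : (\dim (PU U W S) + \dim (S :&: W) = \dim S)%N.
Proof.
rewrite PU_img addnC -(limg_ker_dim pU S); congr (\dim _ + _)%N.
by apply/vspaceP => x; rewrite !memv_cap memv_ker projU_eq0.
Qed.

Lemma projW_ker S : (S :&: lker pW = S :&: U)%VS.
Proof. by apply/vspaceP => x; rewrite !memv_cap memv_ker projW_eq0. Qed.

(** * The action of H on subspaces *)

Definition H_isometry g :=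
  [/\ forall x y, B (g x) (g y) = B x y, forall u, u \in U -> g u \in U &
      forall w, w \in W -> g w \in W].

(** Replaces a pair of isometries of subspace types by one endomorphism of V, so that images of
    subspaces can be computed in V. *)
Lemma in_HP g : in_H B U W g <-> H_isometry g.
Proof.
split=> [[h1 [h2 [[_ i1] [_ i2] h]]]|[gB gU gW]].
  have gU (u : subvs_of U) : g (vsval u) = vsval (h1 u).
    by have := h u 0; rewrite !linear0 !addr0.
  have gW (w : subvs_of W) : g (vsval w) = vsval (h2 w).
    by have := h 0 w; rewrite !linear0 !add0r.
  have iU u v : u \in U -> v \in U -> B (g u) (g v) = B u v.
    by move=> uU vU; rewrite -(vsprojK uU) -(vsprojK vU) !gU i1.
  have iW u v : u \in W -> v \in W -> B (g u) (g v) = B u v.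
    by move=> uU vU; rewrite -(vsprojK uU) -(vsprojK vU) !gW i2.
  have sU u : u \in U -> g u \in U by move=> uU; rewrite -(vsprojK uU) gU subvsP.
  have sW u : u \in W -> g u \in W by move=> uU; rewrite -(vsprojK uU) gW subvsP.
  split=> // x y; rewrite -[in LHS](proj_add x) -[in LHS](proj_add y) !linearD /=.
  rewrite !linearDl /= iU ?memv_pi // [B (g (pW x)) (g (pW y))]iW ?memv_pi //.
  rewrite [B (g (pW x)) (g (pU y))]skewWU ?sU ?sW ?memv_pi // addr0.
  by rewrite [B (g (pU x)) (g (pW y))]skewUW ?sU ?sW ?memv_pi // add0r -skew_proj.
pose h1 : 'End(subvs_of U) := linfun (vsproj U \o g \o vsval).
pose h2 : 'End(subvs_of W) := linfun (vsproj W \o g \o vsval).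
have e1 (u : subvs_of U) : vsval (h1 u) = g (vsval u) by rewrite lfunE /= vsprojK ?gU ?subvsP.
have e2 (u : subvs_of W) : vsval (h2 u) = g (vsval u) by rewrite lfunE /= vsprojK ?gW ?subvsP.
(* An isometry of a nondegenerate form is injective: if g x = 0, then x is orthogonal to
   everything. *)
have inj x : g x = 0 -> x = 0.
  by move=> e; apply: Bnondeg (memvf _) _ => v _; rewrite -gB e linear0l.
exists h1, h2; split.
- split=> [|x y]; last by rewrite !e1 gB.
  apply/eqP; rewrite -subv0; apply/subvP => u; rewrite memv_ker memv0 => /eqP e.
  by apply/eqP; apply: val_inj; apply: inj; rewrite -e1 e.
- split=> [|x y]; last by rewrite !e2 gB.
  apply/eqP; rewrite -subv0; apply/subvP => u; rewrite memv_ker memv0 => /eqP e.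
  by apply/eqP; apply: val_inj; apply: inj; rewrite -e2 e.
- by move=> x y; rewrite linearD /= e1 e2.
Qed.

Lemma H_isometry_ker g : H_isometry g -> lker g == 0%VS.
Proof.
case=> gB _ _; rewrite -subv0; apply/subvP => x; rewrite memv_ker memv0 => /eqP e.
by apply/eqP; apply: Bnondeg (memvf _) _ => v _; rewrite -gB e linear0l.
Qed.

Lemma H_isometry_limg g : H_isometry g -> (g @: U = U)%VS /\ (g @: W = W)%VS.
Proof.
move=> hg; have kg := H_isometry_ker hg; case: hg => _ gU gW.
have dimg X : \dim (g @: X) = \dim X by rewrite limg_dim_eq // (eqP kg) capv0.
split; apply/eqP; rewrite eqEdim dimg leqnn andbT; apply/subvP => _ /memv_imgP[x xX ->].
  exact: gU.
exact: gW.
Qed.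

Lemma H_isometryV g : H_isometry g -> H_isometry (g^-1)%VF.
Proof.
move=> hg; have kg := H_isometry_ker hg; have [eU eW] := H_isometry_limg hg.
have [gB _ _] := hg; split=> [x y|u|w].
- by rewrite -gB !lker0_lfunVK.
- by rewrite -{1}eU => /memv_imgP[v vU ->]; rewrite lker0_lfunK.
- by rewrite -{1}eW => /memv_imgP[v vU ->]; rewrite lker0_lfunK.
Qed.

Lemma H_orbit_sym S T : H_orbit B U W S T -> H_orbit B U W T S.
Proof.
case=> g [/in_HP hg ->]; exists (g^-1)%VF; split; first exact/in_HP/H_isometryV.
by rewrite -limg_comp lker0_compVf ?lim1g // H_isometry_ker.
Qed.

Lemma H_orbit_trans S T X : H_orbit B U W S T -> H_orbit B U W T X -> H_orbit B U W S X.
Proof.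
case=> g [/in_HP[gB gU gW] ->] [h [/in_HP[hB hU hW] ->]].
exists (h \o g)%VF; split; last by rewrite limg_comp.
apply/in_HP; split=> [x y|u uU|w wW]; rewrite !comp_lfunE ?hB //.
  exact/hU/gU.
exact/hW/gW.
Qed.

Lemma orbitO_stable r t S T :
  H_orbit B U W S T -> orbitO B U W r t S -> orbitO B U W r t T.
Proof.
case=> g [/in_HP hg ->] [/andP[/eqP dS iS] <-].
have kg := H_isometry_ker hg; have [eU eW] := H_isometry_limg hg.
have [gB _ _] := hg.
have dimg X : \dim (g @: X) = \dim X by rewrite limg_dim_eq // (eqP kg) capv0.
have ePU : PU U W (g @: S) = (g @: PU U W S)%VS.
  by rewrite /PU -{1}eU -{1}eW -limgD lker0_img_cap.
have eRad X : Rad B (g @: X) = (g @: Rad B X)%VS.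
  apply/vspaceP => x; rewrite memv_cap; apply/andP/memv_imgP.
    case=> /memv_imgP[y yX ->] /mem_orthovP h; exists y => //.
    rewrite memv_cap yX; apply/mem_orthovP => z zX; rewrite -gB h //.
    exact: memv_img.
  case=> y; rewrite memv_cap => /andP[yX /mem_orthovP h] ->.
  split; first exact: memv_img.
  by apply/mem_orthovP => _ /memv_imgP[z zX ->]; rewrite gB h.
split.
  rewrite /isoGr dimg dS eqxx; apply/orthovP => _ _ /memv_imgP[x xS ->] /memv_imgP[y yS ->].
  by rewrite gB; move/orthovP: iS; apply.
have capU X : (g @: X :&: U = g @: (X :&: U))%VS by rewrite -{1}eU -lker0_img_cap.
have capW X : (g @: X :&: W = g @: (X :&: W))%VS by rewrite -{1}eW -lker0_img_cap.
by rewrite /rU /rW /a /b ePU eRad capU capW !dimg.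
Qed.

(** * Normal forms of subspaces with r_U = 0 *)

(* Only p_U is recorded: as S is isotropic, the Gram matrix of the p_W (s i) is
   the opposite of that of the p_U (s i). *)
Definition normal_form (k l r : nat) S := exists s : nat -> V,
  [/\ S = <<mkseq s r>>%VS, free (mkseq (fun i => pU (s i)) l),
      forall i, (l <= i < r)%N -> pU (s i) = 0,
      free (mkseq (fun i => pW (s i)) r) &
      forall i j, (i < l)%N -> (j < l)%N -> B (pU (s i)) (pU (s j)) = std_gram F k i j].

Lemma exists_family (P : nat -> pred V) :
  (forall i, exists x, P i x) -> exists s : nat -> V, forall i, P i (s i).
Proof. by move=> h; exists (fun i => xchoose (h i)) => i; exact: xchooseP. Qed.

Lemma map_mkseq_span (f : 'End(V)) (s : nat -> V) k :
  (f @: <<mkseq s k>> = <<mkseq (fun i => f (s i)) k>>)%VS.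
Proof. by rewrite limg_span -map_comp. Qed.

Lemma free_map_mkseq (f : 'End(V)) (s : nat -> V) k :
    free (mkseq s k) -> (<<mkseq s k>> :&: lker f = 0)%VS ->
  free (mkseq (fun i => f (s i)) k).
Proof.
move=> fs k0; rewrite /free -map_mkseq_span limg_dim_eq //.
by move: fs; rewrite /free !size_mkseq.
Qed.

(** The basis of S consists of lifts along p_U of k hyperbolic pairs and of a basis of the radical
    of [PU U W S], followed by a basis of S :&: W. That r_U = 0 makes p_W injective on S. *)
Lemma orbitO_normal_form k l r S : (k.*2 <= l)%N -> (l <= r)%N ->
  orbitO B U W r (0, r - l, l - k.*2, k.*2)%N S -> normal_form k l r S.
Proof.
move=> kl lr [/andP[/eqP dS _] [rU0 rWe ae be]].
pose P := PU U W S.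
have dP : \dim P = l by have := dim_PU S; rewrite dS -/(rW W S) rWe -/P; lia.
have [k' [e [eP g eqP' dimP]]] := standard_form_Rad Balt P.
have ek : k' = k by move: be; rewrite /b -/P; lia.
subst k'.
pose u i := if (i < k.*2)%N then e i else (vbasis (Rad B P))`_(i - k.*2).
have uP i : u i \in P.
  rewrite /u; case: ifP => [/eP //|_].
  apply: (subvP (capvSl _ _ : Rad B P <= P)%VS).
  have [h|h] := ltnP (i - k.*2) (\dim (Rad B P)).
    by rewrite vbasis_mem // mem_nth ?size_tuple.
  (* Past the basis of the radical the default value 0 still lies in P, so every index has a
     lift. *)
  by rewrite nth_default ?size_tuple ?mem0v.
have mku : mkseq u l = mkseq e k.*2 ++ vbasis (Rad B P).
  rewrite -dP dimP /mkseq iotaD map_cat add0n; congr (_ ++ _).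
    by apply: eq_mkseq_in => i ik; rewrite /u ik.
  rewrite -[X in iota X _]addn0 iotaDl -map_comp -[RHS]mkseq_nth_vbasis.
  by apply: eq_mkseq_in => i _ /=; rewrite /u ltnNge leq_addr /= addKn.
have spanu : <<mkseq u l>>%VS = P.
  by rewrite mku span_cat (span_basis (vbasisP _)) eqP'.
have fu : free (mkseq u l) by rewrite /free spanu size_mkseq dP.
have [lift liftP] : exists s : nat -> V, forall i, (s i \in S) && (pU (s i) == u i).
  apply: (@exists_family (fun i x => (x \in S) && (pU x == u i))) => i.
  have := uP i; rewrite /P PU_img => /memv_imgP[s sS ->].
  by exists s; rewrite sS eqxx.
have dSW : \dim (S :&: W) = (r - l)%N by [].
pose s i := if (i < l)%N then lift i else (vbasis (S :&: W))`_(i - l).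
have sl i : (i < l)%N -> s i \in S /\ pU (s i) = u i.
  by move=> il; rewrite /s il; have /andP[-> /eqP] := liftP i.
have sr i : (l <= i < r)%N -> s i \in (S :&: W)%VS.
  move=> /andP[li ir]; rewrite /s ltnNge li /= vbasis_mem // mem_nth // size_tuple dSW.
  by rewrite ltn_sub2r // (leq_ltn_trans li).
have mks : mkseq s r = mkseq lift l ++ vbasis (S :&: W).
  rewrite -(subnKC lr) /mkseq iotaD map_cat add0n; congr (_ ++ _).
    by apply: eq_mkseq_in => i ik; rewrite /s ik.
  rewrite -[X in iota X _]addn0 iotaDl -map_comp -[RHS]mkseq_nth_vbasis -dSW.
  by apply: eq_mkseq_in => i _ /=; rewrite /s ltnNge leq_addr /= addKn.
have eqU i : (i < l)%N -> pU (s i) = u i by case/sl.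
have eS : S = <<mkseq s r>>%VS.
  apply/eqP; rewrite eqEsubv; apply/andP; split; last first.
    apply/mkseq_span_sub => i ir; have [il|li] := ltnP i l; first by case: (sl i il).
    by have : s i \in (S :&: W)%VS; [apply: sr; rewrite li|rewrite memv_cap => /andP[]].
  apply/subvP => x xS; have : pU x \in P by rewrite /P PU_img memv_img.
  rewrite -spanu => /span_mkseqP [c ec].
  rewrite mks span_cat (span_basis (vbasisP _)).
  rewrite -(subrK (\sum_i c i *: lift i) x) addrC; apply: memv_add.
    by apply: memv_suml => i _; rewrite memvZ ?mem_mkseq_span.
  rewrite memv_cap; apply/andP; split.
    rewrite memvB //; apply: memv_suml => i _; rewrite memvZ //.
    by case/andP: (liftP i).
  rewrite -projU_eq0 linearB /= ec linear_sum subr_eq0; apply/eqP/eq_bigr => i _.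
  by rewrite linearZ /=; have /andP[_ /eqP ->] := liftP i.
have fs : free (mkseq s r) by rewrite /free -eS size_mkseq dS.
exists s; split=> //.
- by rewrite (eq_mkseq_in (v := u)).
- by move=> i /sr; rewrite memv_cap -projU_eq0 => /andP[_ /eqP].
- apply: free_map_mkseq => //; rewrite -eS projW_ker; apply/eqP.
  by rewrite -dimv_eq0; apply/eqP.
- move=> i j il jl; rewrite !eqU //.
  have radu x : x \in P -> forall a, (k.*2 <= a < l)%N -> B (u a) x = 0.
    move=> xP a /andP[ka al]; rewrite /u ltnNge ka /=.
    have : (vbasis (Rad B P))`_(a - k.*2) \in Rad B P.
      by rewrite vbasis_mem // mem_nth // size_tuple; lia.
    by rewrite memv_cap => /andP[_ /mem_orthovP]; apply.
  have [ik|ki] := ltnP i k.*2; last by rewrite radu ?ki // std_gram_eq0 ?ki.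
  have [jk|kj] := ltnP j k.*2; last first.
    by rewrite (skewC B) radu ?kj // std_gram_eq0 ?kj ?orbT ?oppr0.
  by rewrite /u ik jk g.
Qed.

Lemma normal_form_conj k l r S T : (l <= r)%N ->
    (S <= orthov B S)%VS -> (T <= orthov B T)%VS ->
  normal_form k l r S -> normal_form k l r T -> H_orbit B U W S T.
Proof.
move=> lr /orthovP iS /orthovP iT [s [eS fUs s0 fWs gs]] [t [eT fUt t0 fWt gt]].
have sS i : (i < r)%N -> s i \in S by move=> ir; rewrite eS mem_mkseq_span.
have tT i : (i < r)%N -> t i \in T by move=> ir; rewrite eT mem_mkseq_span.
have [i _|i _|i j il jl|l1 [l1U h1]] := witt Balt nondegU _ _ fUs fUt.
- exact: memv_pi.
- exact: memv_pi.
- by rewrite gs ?gt.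
(* Isotropy makes the Gram matrix on the W side the opposite of the one on the U side, which the
   normal form prescribes, the entries beyond l being zero. *)
have gW i j : (i < r)%N -> (j < r)%N ->
    B (pW (s i)) (pW (s j)) = B (pW (t i)) (pW (t j)).
  have eqB (x : nat -> V) : (forall i j, (i < r)%N -> (j < r)%N -> B (x i) (x j) = 0) ->
     (i < r)%N -> (j < r)%N -> B (pW (x i)) (pW (x j)) = - B (pU (x i)) (pU (x j)).
    move=> h ir jr; apply/eqP; rewrite -subr_eq0 opprK addrC -skew_proj.
    by rewrite h.
  move=> ir jr; rewrite !eqB //; last 2 first.
  - by move=> a b ar br; apply: iT; apply: tT.
  - by move=> a b ar br; apply: iS; apply: sS.
  congr (- _).
  have [il|li] := ltnP i l; last first.
    have e : (l <= i < r)%N by rewrite li.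
    by rewrite s0 // t0 // !linear0l.
  have [jl|lj] := ltnP j l; last first.
    have e : (l <= j < r)%N by rewrite lj.
    by rewrite [pU (s j)]s0 // [pU (t j)]t0 // !linear0r.
  by rewrite gs ?gt.
have [i _|i _|l2 [l2W h2]] := witt Balt nondegW _ _ fWs fWt gW.
- exact: memv_pi.
- exact: memv_pi.
(* Transvections along U fix W pointwise and conversely, so the concatenation acts as the first
   product on U and as the second on W. *)
pose g : 'End(V) := linfun (transvect B (l1 ++ l2) 1).
have gE x : g x = transvect B l1 1 (transvect B l2 1 x) by rewrite lfunE /= transvect_cat.
have fixU x : x \in U -> transvect B l2 1 x = x.
  by move=> xU; apply: transvect_fix => vc /l2W vW; rewrite skewUW.
have fixW x : x \in W -> transvect B l1 1 x = x.
  by move=> xU; apply: transvect_fix => vc /l1U vW; rewrite skewWU.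
have gU x : x \in U -> g x = transvect B l1 1 x by move=> xU; rewrite gE fixU.
have gWE x : x \in W -> g x = transvect B l2 1 x.
  by move=> xU; rewrite gE fixW // transvect_stable.
exists g; split.
  apply/in_HP; split=> [x y|x xU|x xW]; first by rewrite !gE !transvect_isom.
    by rewrite gU // transvect_stable.
  by rewrite gWE // transvect_stable.
rewrite eS eT map_mkseq_span; congr <<_>>%VS; apply: eq_mkseq_in => i ir.
rewrite -[LHS]proj_add -[in RHS](proj_add (s i)) linearD /=.
rewrite gU ?memv_pi // gWE ?memv_pi // h2 //.
congr (_ + _); have [il|li] := ltnP i l; first by rewrite h1.
have e : (l <= i < r)%N by rewrite li.
by rewrite s0 // t0 // linear0.
Qed.

Lemma normal_form_orbitO k l r S : (k.*2 <= l)%N -> (l <= r)%N -> isoGr B r S ->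
  normal_form k l r S -> orbitO B U W r (0, r - l, l - k.*2, k.*2)%N S.
Proof.
move=> kl lr isoS [s [eS fUs s0 fWs gs]]; split=> //.
have dS : \dim S = r by case/andP: isoS => /eqP.
set u := fun i => pU (s i) in fUs gs.
have eP : PU U W S = <<mkseq u l>>%VS.
  rewrite PU_img eS map_mkseq_span; apply/eqP; rewrite eqEsubv.
  apply/andP; split; apply/mkseq_span_sub => i il; last first.
    by apply: (mem_mkseq_span u); apply: leq_trans lr.
  have [?|li] := ltnP i l; first exact: (mem_mkseq_span u).
  by rewrite s0 ?li // mem0v.
have dP : \dim (PU U W S) = l.
  by rewrite eP; move: fUs; rewrite /free size_mkseq => /eqP.
have rWe : rW W S = (r - l)%N by have := dim_PU S; rewrite dP dS -/(rW W S); lia.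
have rUe : rU U S = 0%N.
  have := limg_ker_dim pW S; rewrite projW_ker {2}eS map_mkseq_span.
  move: fWs; rewrite /free size_mkseq => /eqP ->; rewrite dS /rU; lia.
have dR : \dim (Rad B (PU U W S)) = (l - k.*2)%N.
  have g i j : (i < k.*2)%N -> (j < k.*2)%N -> B (u i) (u j) = std_gram F k i j.
    by move=> ik jk; apply: gs; apply: leq_trans kl.
  have uP i : (i < k.*2)%N -> u i \in PU U W S.
    by move=> ik; rewrite eP; apply: (mem_mkseq_span u); apply: leq_trans kl.
  (* The hyperbolic pairs meet the radical trivially, which bounds its dimension above; the other l
     - 2k vectors lie in it, which bounds it below. *)
  apply/eqP; rewrite eqn_leq; apply/andP; split.
    have := dimvS (capvSl _ _ : (Rad B (PU U W S) <= PU U W S))%VS.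
    have := dimv_disjoint_sum (std_gram_cap_Rad g uP).
    have := std_gram_free g; rewrite /free size_mkseq => /eqP ->.
    have : (<<mkseq u k.*2>> + Rad B (PU U W S) <= PU U W S)%VS.
      by rewrite subv_add capvSl andbT; apply/mkseq_span_sub.
    by move/dimvS; rewrite dP => h e _; rewrite leq_subRL // -e.
  have -> : (l - k.*2)%N = \dim <<mkseq (fun i => u (k.*2 + i)%N) (l - k.*2)>>.
    have : free (mkseq u k.*2 ++ mkseq (fun i => u (k.*2 + i)%N) (l - k.*2)).
      suff -> : mkseq u k.*2 ++ mkseq (fun i => u (k.*2 + i)%N) (l - k.*2) = mkseq u l.
        exact: fUs.
      rewrite -[in RHS](subnKC kl) /mkseq iotaD map_cat add0n; congr (_ ++ _).
      by rewrite -[X in _ = map _ (iota X _)]addn0 iotaDl -map_comp.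
    by move/catr_free; rewrite /free size_mkseq => /eqP.
  apply: dimvS; apply/mkseq_span_sub => i il; rewrite memv_cap; apply/andP; split.
    by rewrite eP; apply: (mem_mkseq_span u); lia.
  apply/mem_orthovP => x; rewrite eP => /span_mkseqP[c ->].
  rewrite skew_sumr big1 // => j _; rewrite skewZr gs ?ltn_ord //; last by lia.
  by rewrite std_gram_eq0 ?leq_addr // mulr0.
rewrite rUe rWe /a /b dR dP -/(rU U S) rUe; congr (_, _, _, _); lia.
Qed.

Lemma free_subfamily (e : nat -> V) n (idx : nat -> nat) l :
    free (mkseq e n) -> {in gtn l &, injective idx} ->
    (forall i, (i < l)%N -> (idx i < n)%N) ->
  free (mkseq (fun i => e (idx i)) l).
Proof.
move=> fe inj lt; pose s := mkseq idx l.
have us : uniq s by apply/mkseq_uniqP.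
have ps : perm_eq s (filter (mem s) (iota 0 n)).
  apply: uniq_perm => [||x]; rewrite ?filter_uniq ?iota_uniq // mem_filter /=.
  rewrite mem_iota /= add0n; case: (boolP (x \in s)) => //= /mapP[i].
  by rewrite mem_iota => il ->; rewrite lt.
have -> : mkseq (fun i => e (idx i)) l = map e s by rewrite /s /mkseq -map_comp.
rewrite (perm_free (perm_map e ps)).
apply: (@catl_free _ _ (map e (filter (predC (mem s)) (iota 0 n)))).
by rewrite -map_cat (perm_free (perm_map e (permEl (perm_filterC _ _)))).
Qed.

Lemma std_gram_family X k l : nondeg_on B X -> (k.*2 <= l)%N -> ((l - k).*2 <= \dim X)%N ->
  exists u : nat -> V, [/\ forall i, (i < l)%N -> u i \in X, free (mkseq u l) &
    forall i j, (i < l)%N -> (j < l)%N -> B (u i) (u j) = std_gram F k i j].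
Proof.
move=> nX kl ld; have [K [e [eX g _ dimX]]] := standard_form_Rad Balt X.
have R0 : Rad B X = 0%VS.
  apply/eqP; rewrite -subv0; apply/subvP => x; rewrite memv_cap memv0.
  by move=> /andP[xX /mem_orthovP h]; apply/eqP; apply: nX.
move: ld; rewrite dimX R0 dimv0 addn0 => ld.
(* After k whole pairs, only the first vector of each further pair is kept: 2 (i - k) = 2k + 2 (i -
   2k). This consumes l - k pairs, whence the bound on [\dim X]. *)
pose idx i := if (i < k.*2)%N then i else (i - k).*2.
have lt i : (i < l)%N -> (idx i < K.*2)%N by rewrite /idx; case: ifP; lia.
exists (fun i => e (idx i)); split=> [i /lt/eX //||i j il jl].
  apply: (free_subfamily (std_gram_free g)) => // i j _ _.
  by rewrite /idx; do 2 case: ifP; lia.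
rewrite g ?lt // /std_gram; have := lt i il; have := lt j jl; rewrite /idx.
case: ifP => hj; case: ifP => hi b1 b2.
- by congr (_%:R * _); congr (nat_of_bool _); lia.
- have -> : (i./2 == j./2) && (i./2 < k)%N = false by lia.
  have -> : ((i - k).*2./2 == j./2) = false by lia.
  by rewrite !mul0r.
- have -> : (i./2 == j./2) && (i./2 < k)%N = false by lia.
  have -> : (i./2 == (j - k).*2./2) = false by lia.
  by rewrite !mul0r.
- have -> : (i./2 == j./2) && (i./2 < k)%N = false by lia.
  by rewrite !odd_double subrr mul0r mulr0.
Qed.

Lemma normal_form_exists k l r : (k.*2 <= l)%N -> (l <= r)%N ->
    ((l - k).*2 <= \dim U)%N -> ((r - k).*2 <= \dim W)%N ->
  exists2 S, isoGr B r S & normal_form k l r S.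
Proof.
move=> kl lr lU rW.
have [u [uU fu gu]] := std_gram_family nondegU kl lU.
have [w [wW fw gw]] := std_gram_family nondegW (leq_trans kl lr) rW.
pose x i := if (i < l)%N then u i else 0.
(* The signs make the Gram matrix of y opposite to that of x, so that the span of the sums x i + y i
   is isotropic. *)
pose y i := (-1) ^+ odd i *: w i.
have xU i : x i \in U by rewrite /x; case: ifP => [/uU//|_]; rewrite mem0v.
have yW i : (i < r)%N -> y i \in W by move=> ir; rewrite memvZ ?wW.
pose s i := x i + y i.
have sU i : (i < r)%N -> pU (s i) = x i.
  move=> ir; rewrite linearD /= projU_id //.
  by have /eqP -> : pU (y i) == 0; rewrite ?addr0 // projU_eq0 yW.
have sW i : (i < r)%N -> pW (s i) = y i.
  move=> ir; rewrite linearD /= [pW (y i)]projW_id ?yW //.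
  by have /eqP -> : pW (x i) == 0; rewrite ?add0r // projW_eq0 xU.
have fy : free (mkseq y r).
  apply/free_mkseqP => c e i; have /free_mkseqP h := fw.
  have : c i * (-1) ^+ odd i = 0.
    apply: (h (fun i => c i * (-1) ^+ odd i)); rewrite -[RHS]e.
    by apply: eq_bigr => j _; rewrite scalerA.
  by move/eqP; rewrite mulf_eq0 signr_eq0 orbF => /eqP.
have fs : free (mkseq s r).
  apply/free_mkseqP => c e i; move/free_mkseqP: fy; apply.
  transitivity (pW (\sum_j c j *: s j)); last by rewrite e linear0.
  rewrite linear_sum; apply: eq_bigr => j _.
  by rewrite [RHS]linearZ /= sW.
exists <<mkseq s r>>%VS; last first.
  exists s; split=> //.
  - by rewrite (eq_mkseq_in (v := u)) // => i il; rewrite sU ?(leq_trans il) // /x il.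
  - by move=> i /andP[li ir]; rewrite sU // /x ltnNge li.
  - by rewrite (eq_mkseq_in (v := y)).
  - move=> i j il jl; rewrite !sU ?(leq_trans _ lr) // /x il jl gu //.
rewrite /isoGr; apply/andP; split; first by move: fs; rewrite /free size_mkseq.
apply/orthovP => _ _ /span_mkseqP[c ->] /span_mkseqP[d ->].
rewrite skew_suml big1 // => i _; rewrite skew_sumr big1 // => j _.
rewrite skewZl skewZr skew_proj !sU ?sW // !skewZl !skewZr gw //.
rewrite [(-1) ^+ odd i * _]mulrA std_gram_weight.
have [il|li] := ltnP i l; last first.
  by rewrite /x ltnNge li linear0l std_gram_eq0 ?(leq_trans kl li) // subr0 !mulr0.
have [jl|lj] := ltnP j l; last first.
  rewrite /x [(j < l)%N]ltnNge lj linear0r std_gram_eq0 ?(leq_trans kl lj) ?orbT //.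
  by rewrite subr0 !mulr0.
by rewrite /x il jl gu // subrr !mulr0.
Qed.

(** * Bordered determinants as quadratic forms *)

Section Bordered.
Variables (r q : nat) (x y : 'I_q -> V).

Definition gramU : 'M[F]_(\dim {:V}) :=
  \matrix_(i, j) B (pU (vbasis fullv)`_i) (pU (vbasis fullv)`_j).
Definition pair_right : 'M[F]_(\dim {:V}, q) := \matrix_(i, j) B (vbasis fullv)`_i (x j).
Definition pair_left : 'M[F]_(q, \dim {:V}) := \matrix_(i, j) B (y i) (vbasis fullv)`_j.

Definition borderedU (s : nat -> V) : 'M[F]_(r + q) :=
  block_mx (\matrix_(i < r, j < r) B (pU (s i)) (pU (s j)))
           (\matrix_(i < r, j < q) B (s i) (x j))
           (\matrix_(i < q, j < r) B (y i) (s j)) 0.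

Lemma borderedUE s :
  borderedU s = bordered gramU pair_right pair_left (coord_mx r s).
Proof.
have sE i : s i = \sum_j coord (vbasis fullv) j (s i) *: (vbasis fullv)`_j.
  by rewrite -coord_vbasis ?memvf.
congr block_mx; apply/matrixP => i j; rewrite !mxE.
- rewrite [s i]sE [s j]sE !(linear_sum pU) /= skew_sumr; apply: eq_bigr => b _.
  rewrite skew_suml !mxE mulr_suml; apply: eq_bigr => a _.
  by rewrite ![pU (_ *: _)]linearZ /= skewZl skewZr !mxE; ring.
- by rewrite [s i]sE skew_suml; apply: eq_bigr => a _; rewrite skewZl !mxE.
- by rewrite [s j]sE skew_sumr; apply: eq_bigr => a _; rewrite skewZr !mxE mulrC.
Qed.

(** The expansion of [det_bordered] with each minor replaced by a variable. *)
Definition bordered_poly : {mpoly F[plucker_dim V r]} :=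
  \sum_k \sum_l bordered_coef gramU pair_right pair_left (enum_val k) (enum_val l)
                *: ('X_k * 'X_l).

Lemma bordered_poly_homog : bordered_poly \is 2.-homog.
Proof.
apply: rpred_sum => k _; apply: rpred_sum => l _; apply: rpredZ.
by rewrite -[2%N]/(1 + 1)%N dhomogM // dhomogX /= mdeg1.
Qed.

Lemma bordered_polyE S :
  bordered_poly.@[plucker S] = \det (borderedU (nth 0 (vbasis S))).
Proof.
rewrite borderedUE det_bordered /bordered_poly [LHS]raddf_sum [RHS]big_enum_val /=.
apply: eq_bigr => k _; rewrite [LHS]raddf_sum [RHS]big_enum_val /=; apply: eq_bigr => l _.
by rewrite mevalZ mevalM !mevalXU !pluckerE mulrA.
Qed.

End Bordered.

(** * The radical on S and invertibility of the bordered matrix *)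

(* The radical of the form B (p_U s, p_U t) on S. *)
Definition radU S := (S :&: (Rad B (PU U W S) + W))%VS.

Lemma radUP S s : s \in S ->
  reflect (forall t, t \in S -> B (pU s) (pU t) = 0) (s \in radU S).
Proof.
move=> sS; apply: (iffP idP) => [|h].
  rewrite memv_cap => /andP[_ /memv_addP[u uR [w wW ->]]] t tS.
  have := uR; rewrite memv_cap => /andP[uP /mem_orthovP uO].
  have uU : u \in U by move: uP; rewrite /PU memv_cap => /andP[].
  rewrite linearD /= projU_id //.
  have /eqP -> : pU w == 0 by rewrite projU_eq0.
  by rewrite addr0 uO // PU_img memv_img.
rewrite memv_cap sS -(proj_add s) memv_add ?memv_pi //.
rewrite memv_cap PU_img memv_img //; apply/mem_orthovP => _ /memv_imgP[t tS ->].
exact: h.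
Qed.

Lemma radU_sub S : (radU S <= S)%VS.
Proof. exact: capvSl. Qed.

Lemma capU_radU S : (S <= orthov B S)%VS -> (S :&: U <= radU S)%VS.
Proof.
move=> /orthovP iS; apply/subvP => s; rewrite memv_cap => /andP[sS sU].
apply/radUP => // t tS; rewrite projU_id // (skewC B) -skewU // -(skewC B).
by apply: iS.
Qed.

Lemma capW_radU S : (S :&: W <= radU S)%VS.
Proof.
apply/subvP => s; rewrite memv_cap -projU_eq0 => /andP[sS /eqP s0].
by apply/radUP => // t tS; rewrite s0 linear0l.
Qed.

Lemma mem_vbasisE r S s : \dim S = r -> s \in S ->
  exists c : 'rV[F]_r, s = \sum_i c 0 i *: (vbasis S)`_i.
Proof.
move=> dS sS; subst r; exists (\row_i coord (vbasis S) i s).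
by rewrite {1}(coord_vbasis sS); apply: eq_bigr => i _; rewrite mxE.
Qed.

Lemma vbasis_sum_eq0 r S (c : 'rV[F]_r) : \dim S = r ->
  \sum_i c 0 i *: (vbasis S)`_i = 0 -> c = 0.
Proof.
move=> dS; subst r => e; apply/rowP => i; rewrite mxE.
have /freeP := basis_free (vbasisP S); exact.
Qed.

Lemma mem_vbasis_nth r S (i : 'I_r) : \dim S = r -> (vbasis S)`_i \in S.
Proof. by move=> dS; rewrite vbasis_mem // mem_nth // size_tuple dS. Qed.

Section BorderedDet.
Variables (r q : nat) (x y : 'I_q -> V) (S : {vspace V}).
Hypothesis dS : \dim S = r.
Let s := nth 0 (vbasis S).

(** If c is the coordinate row of n, then (c, 0) times the bordered matrix is zero: its first block
    vanishes as n is in the radical, its second consists of the B n (x j). *)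
Lemma borderedU_right : \det (borderedU r x y s) != 0 ->
  forall n, n \in radU S -> (forall j, B n (x j) = 0) -> n = 0.
Proof.
move=> nz n nN nx; have nS := subvP (radU_sub S) _ nN.
have [c ec] := mem_vbasisE dS nS; suff c0 : c = 0.
  by rewrite ec big1 // => i _; rewrite c0 mxE scale0r.
apply/eqP; apply: contraNT nz => c0; apply/det0P; exists (row_mx c 0).
  by apply: contra_neq c0 => /(congr1 (@lsubmx _ _ _ _)); rewrite row_mxKl linear0.
rewrite mul_row_block !mul0mx !addr0 -[RHS]row_mx0; congr row_mx.
  apply/rowP => j; have /radUP h := nN; rewrite !mxE.
  rewrite -[RHS](h nS (s j)) ?mem_vbasis_nth // [in RHS]ec linear_sum skew_suml.
  by apply: eq_bigr => i _; rewrite linearZ skewZl /= mxE.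
apply/rowP => j; rewrite !mxE -[RHS](nx j) [in RHS]ec skew_suml.
by apply: eq_bigr => i _; rewrite skewZl /= mxE.
Qed.

Lemma borderedU_left : \det (borderedU r x y s) != 0 ->
  forall n, n \in radU S -> (forall j, B (y j) n = 0) -> n = 0.
Proof.
move=> nz n nN ny; have nS := subvP (radU_sub S) _ nN.
have [c ec] := mem_vbasisE dS nS; suff c0 : c = 0.
  by rewrite ec big1 // => i _; rewrite c0 mxE scale0r.
apply/eqP; apply: contraNT nz => c0; rewrite -det_tr; apply/det0P.
exists (row_mx c 0).
  by apply: contra_neq c0 => /(congr1 (@lsubmx _ _ _ _)); rewrite row_mxKl linear0.
rewrite tr_block_mx mul_row_block !mul0mx !addr0 -[RHS]row_mx0; congr row_mx.
  apply/rowP => j; have /radUP h := nN; rewrite !mxE.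
  rewrite -[RHS]oppr0 -[in RHS](h nS (s j)) ?mem_vbasis_nth // -(skewC B).
  rewrite [in RHS]ec linear_sum skew_sumr.
  by apply: eq_bigr => i _; rewrite linearZ skewZr /= !mxE.
apply/rowP => j; rewrite !mxE -[RHS](ny j) [in RHS]ec skew_sumr.
by apply: eq_bigr => i _; rewrite skewZr /= !mxE.
Qed.

(** Pairing with the q vectors x j embeds the radical into F^q. *)
Lemma dim_radU_le : \det (borderedU r x y s) != 0 -> (\dim (radU S) <= q)%N.
Proof.
move=> nz; pose M : 'M[F]_(\dim (radU S), q) := \matrix_(i, j) B (vbasis (radU S))`_i (x j).
have : row_free M.
  apply: inj_row_free => v vM; apply: (vbasis_sum_eq0 erefl).
  apply: (borderedU_right nz) => [|j].
    by apply: memv_suml => i _; rewrite memvZ // mem_vbasis_nth.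
  rewrite skew_suml; have := congr1 (fun z : 'rV_ _ => z 0 j) vM.
  rewrite !mxE => e; rewrite -[RHS]e; apply: eq_bigr => i _.
  by rewrite skewZl [in RHS]mxE.
by move/eqP <-; exact: rank_leq_col.
Qed.

(** A row (c, d) killed by the matrix gives z in S and t in the span of y with B (p_U z) (p_U n) + B
    t n = 0 on S. On the radical the first term vanishes, so d = 0 and t = 0; then z is in the
    radical and orthogonal to all x j, so z = 0. *)
Lemma borderedU_neq0 :
    (forall n, n \in radU S -> (forall j, B n (x j) = 0) -> n = 0) ->
    (forall d : 'rV[F]_q,
       (forall n, n \in radU S -> B (\sum_i d 0 i *: y i) n = 0) -> d = 0) ->
  \det (borderedU r x y s) != 0.
Proof.
move=> hx hy; apply/det0P => -[v /eqP v0 vA]; apply: v0; move: vA.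
rewrite -[v]hsubmxK mul_row_block mulmx0 addr0.
set c := lsubmx v; set d := rsubmx v => e.
have [z ez] : exists z, z = \sum_i c 0 i *: s i by eexists.
have [t et] : exists t, t = \sum_i d 0 i *: y i by eexists.
have zS : z \in S by rewrite ez; apply: memv_suml => i _; rewrite memvZ // mem_vbasis_nth.
have e1 n : n \in S -> B (pU z) (pU n) + B t n = 0.
  move=> nS; have [a ->] := mem_vbasisE dS nS.
  rewrite (linear_sum pU) /= !skew_sumr -big_split big1 //= => j _.
  rewrite linearZ /= !skewZr -mulrDr.
  have := congr1 (fun w : 'rV_(r + q) => w 0 (lshift q j)) e.
  rewrite !mxE; case: splitP => [j' /= /val_inj <-|j' /= E]; last first.
    by have := ltn_ord j; rewrite E ltnNge leq_addr.
  rewrite !mxE => e'.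
  suff -> : B (pU z) (pU (vbasis S)`_j) + B t (vbasis S)`_j = 0 by rewrite mulr0.
  rewrite -[RHS]e' ez et (linear_sum pU) /= !skew_suml.
  congr (_ + _); apply: eq_bigr => i _.
    by rewrite linearZ skewZl /= [in RHS]mxE.
  by rewrite skewZl /= [in RHS]mxE.
have e2 j : B z (x j) = 0.
  have := congr1 (fun w : 'rV_(r + q) => w 0 (rshift r j)) e.
  rewrite !mxE; case: splitP => [j' /= E|j' /= /addnI/val_inj <-].
    by have := ltn_ord j'; rewrite -E ltnNge leq_addr.
  rewrite !mxE => e'; rewrite -[RHS]e' ez skew_suml; apply: eq_bigr => i _.
  by rewrite skewZl; congr (_ * _); rewrite mxE.
have d0 : d = 0.
  apply: hy => n nN; have nS := subvP (radU_sub S) _ nN.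
  rewrite -et -[RHS](e1 n nS) (skewC B (pU z)).
  by have /radUP -> := nN; rewrite ?oppr0 ?add0r.
have t0 : t = 0 by rewrite et big1 // => i _; rewrite d0 mxE scale0r.
have z0 : z = 0.
  by apply: hx => //; apply/radUP => // n nS; rewrite -[RHS](e1 n nS) t0 linear0l addr0.
by rewrite ez in z0; rewrite d0 (vbasis_sum_eq0 dS z0) row_mx0.
Qed.

End BorderedDet.

(** Vectors of X see v only through f v, so a family in X dual to the images of a basis of N is dual
    to that basis. *)
Lemma dual_projection q (N X : {vspace V}) (f : 'End(V)) : nondeg_on B X ->
    (forall v, f v \in X) -> (forall v x, x \in X -> B v x = B (f v) x) ->
    (N :&: lker f = 0)%VS -> \dim N = q ->
  exists x : 'I_q -> V, (forall j, x j \in X) /\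
    forall i j : 'I_q, B (vbasis N)`_i (x j) = (i == j)%:R.
Proof.
move=> nX fX fB N0 dN.
have fN : free (mkseq (fun i => f (vbasis N)`_i) q).
  apply: (free_map_mkseq (s := nth 0 (vbasis N))); rewrite -dN mkseq_nth_vbasis.
    exact: basis_free (vbasisP N).
  by rewrite (span_basis (vbasisP N)).
have [x [xX xd]] := dual_family nX (fun i _ => fX _) fN.
by exists x; split=> // i j; rewrite fB.
Qed.

(** Both borders are dual to a basis of the radical. The pair Y, f stands for U with p_U or for W
    with p_W, the two origins of the left border. *)
Lemma borderedU_exists r q (Y S : {vspace V}) (f : 'End(V)) :
    nondeg_on B Y -> (forall v, f v \in Y) ->
    (forall v x, x \in Y -> B v x = B (f v) x) -> (radU S :&: lker f = 0)%VS ->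
    (radU S :&: U = 0)%VS -> \dim S = r -> \dim (radU S) = q ->
  exists x y : 'I_q -> V, [/\ forall j, x j \in W, forall j, y j \in Y &
    \det (borderedU r x y (nth 0 (vbasis S))) != 0].
Proof.
move=> nY fY fB Y0 U0 dS dN.
have [|x [xW xd]] :=
    @dual_projection q (radU S) W pW nondegW (fun v => memv_pi _ _ v) skewW _ dN.
  by rewrite projW_ker.
have [y [yY yd]] := dual_projection nY fY fB Y0 dN.
exists x, y; split=> //; apply: borderedU_neq0 => // [n nN nx|d hd].
  have [c ec] := mem_vbasisE dN nN; rewrite ec big1 // => i _.
  have := nx i; rewrite ec skew_suml (bigD1 i) //= big1 => [|j ji].
    by rewrite addr0 skewZl xd eqxx mulr1 => ->; rewrite scale0r.
  by rewrite skewZl xd (negPf ji) mulr0.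
apply/rowP => i; rewrite mxE; have := hd _ (mem_vbasis_nth i dN).
rewrite skew_suml (bigD1 i) //= big1 => [|j ji].
  rewrite addr0 skewZl (skewC B) yd eqxx mulrN1 => /eqP.
  by rewrite oppr_eq0 => /eqP.
by rewrite skewZl (skewC B) yd eq_sym (negPf ji) oppr0 mulr0.
Qed.

(** * Openness and uniqueness of the orbits *)

Lemma zariski_open_bordered r q (Y : {vspace V}) (O : {vspace V} -> Prop) :
    (forall S, isoGr B r S -> O S <->
      exists x y : 'I_q -> V, [/\ forall j, x j \in W, forall j, y j \in Y &
        \det (borderedU r x y (nth 0 (vbasis S))) != 0]) ->
    (forall S, O S -> isoGr B r S) ->
  zariski_open B r O.
Proof.
move=> hO Oiso; split=> //.
exists (fun p => exists x y : 'I_q -> V,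
  [/\ forall j, x j \in W, forall j, y j \in Y & p = bordered_poly r x y]).
split=> [p [x [y [_ _ ->]]]|S]; first by exists 2%N; exact: bordered_poly_homog.
split=> -[iS h]; split=> //.
  move=> p [x [y [xW yY ->]]]; rewrite bordered_polyE; apply/eqP.
  apply: contraT => nz; case: h; apply/(hO _ iS); by exists x, y.
move/(hO _ iS) => [x [y [xW yY /negP]]]; apply; apply/eqP.
by rewrite -bordered_polyE; apply: h; exists x, y.
Qed.

Lemma dim_radU S : \dim (radU S) = (\dim (Rad B (PU U W S)) + rW W S)%N.
Proof. exact: dim_cap_RadPU. Qed.

(* Pairing with W kills S :&: U and pairing with U kills S :&: W; the corank of
   an alternating form on S has the parity of r, so it is r - 2k as soon as it is
   at most r - 2k <= 1. *)
Lemma open_generic k r : (k.*2 <= r)%N -> (r - k.*2 <= 1)%N ->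
  zariski_open B r (orbitO B U W r (0, 0, r - k.*2, k.*2)%N).
Proof.
move=> kr q1; apply: (@zariski_open_bordered r (r - k.*2) U) => [S isoS|S []//].
have /andP[/eqP dS iS] := isoS; split=> [[_ [rU0 rW0 ae be]]|[x [y [xW yU nz]]]].
  have dP : \dim (PU U W S) = r by have := dim_PU S; rewrite -/(rW W S) rW0 dS addn0.
  have dN : \dim (radU S) = (r - k.*2)%N.
    by rewrite dim_radU rW0 addn0 -ae /a -/(rU U S) rU0 subn0.
  have U0 : (radU S :&: U = 0)%VS.
    apply/eqP; rewrite -dimv_eq0 -leqn0 -rU0; apply/dimvS/capvS => //; exact: radU_sub.
  apply: (@borderedU_exists _ _ U S pU) => //; first exact: nondegU.
  - by move=> v; exact: memv_pi.
  - exact: skewU.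
  - apply/eqP; rewrite -dimv_eq0 -leqn0 -rW0; apply: dimvS; apply/subvP => v.
    by rewrite !memv_cap memv_ker projU_eq0 => /andP[/andP[-> _] ->].
have le := dim_radU_le dS nz.
have rU0 : rU U S = 0%N.
  apply/eqP; rewrite /rU dimv_eq0 -subv0; apply/subvP => u uS.
  rewrite memv0; apply/eqP; apply: (borderedU_right dS nz).
    exact: (subvP (capU_radU iS)).
  by move=> j; move: uS; rewrite memv_cap => /andP[_ uU]; rewrite skewUW.
have rW0 : rW W S = 0%N.
  apply/eqP; rewrite /rW dimv_eq0 -subv0; apply/subvP => u uS.
  rewrite memv0; apply/eqP; apply: (borderedU_left dS nz).
    exact: (subvP (capW_radU S)).
  by move=> j; move: uS; rewrite memv_cap => /andP[_ uU]; rewrite skewUW.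
move: le; rewrite dim_radU rW0 addn0 => le.
have dP : \dim (PU U W S) = r by have := dim_PU S; rewrite -/(rW W S) rW0 dS addn0.
have [k' [e [_ _ _]]] := standard_form_Rad Balt (PU U W S); rewrite dP => dR.
have dRe : \dim (Rad B (PU U W S)) = (r - k.*2)%N by lia.
split=> //; rewrite /a /b -/(rU U S) rU0 rW0 dRe dP; congr (_, _, _, _); lia.
Qed.

(** As dim P_U S <= 2k, r_W >= r - 2k; so if r_W + dim Rad (P_U S) <= r - 2k, then r_W = r - 2k and
    the radical of P_U S is zero. Both borders come from W: for r > 2k, S :&: W is a nonzero part of
    the radical that pairing with U would kill. *)
Lemma open_full k r : \dim U = k.*2 -> (k.*2 <= r)%N ->
  zariski_open B r (orbitO B U W r (0, r - k.*2, 0, k.*2)%N).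
Proof.
move=> dU kr; apply: (@zariski_open_bordered r (r - k.*2) W) => [S isoS|S []//].
have /andP[/eqP dS iS] := isoS; split=> [[_ [rU0 rWe ae be]]|[x [y [xW yU nz]]]].
  have dP : \dim (PU U W S) = k.*2.
    by have := dim_PU S; rewrite -/(rW W S) rWe dS; lia.
  have dN : \dim (radU S) = (r - k.*2)%N.
    by rewrite dim_radU rWe; move: ae; rewrite /a -/(rU U S) rU0 subn0 => ->.
  have U0 : (radU S :&: U = 0)%VS.
    apply/eqP; rewrite -dimv_eq0 -leqn0 -rU0; apply/dimvS/capvS => //; exact: radU_sub.
  apply: (@borderedU_exists _ _ W S pW) => //; first exact: nondegW.
  - by move=> v; exact: memv_pi.
  - exact: skewW.
  - by rewrite projW_ker.
have le := dim_radU_le dS nz.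
have rU0 : rU U S = 0%N.
  apply/eqP; rewrite /rU dimv_eq0 -subv0; apply/subvP => u uS.
  rewrite memv0; apply/eqP; apply: (borderedU_right dS nz).
    exact: (subvP (capU_radU iS)).
  by move=> j; move: uS; rewrite memv_cap => /andP[_ uU]; rewrite skewUW.
have PUle : (\dim (PU U W S) <= k.*2)%N by rewrite -dU dimvS // capvSr.
have := dim_PU S; rewrite -/(rW W S) dS => eP.
move: le; rewrite dim_radU => le.
split=> //; rewrite /a /b -/(rU U S) rU0.
have -> : rW W S = (r - k.*2)%N by lia.
by congr (_, _, _, _); lia.
Qed.

Lemma H_orbit_refl S : H_orbit B U W S S.
Proof.
exists \1%VF; rewrite lim1g; split=> //.
by apply/in_HP; split=> [x y|u uU|w wW]; rewrite !id_lfunE.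
Qed.

(** For isotropic S, [radU] is the same whether computed on U or on W; written through it, a and b
    become visibly symmetric in the two summands. *)
Lemma a_radU S : a B U W S = (\dim (radU S) - (rU U S + rW W S))%N.
Proof. by rewrite dim_radU subnDr. Qed.

Lemma b_radU S : b B U W S = (\dim S - \dim (radU S))%N.
Proof. by rewrite dim_radU -(dim_PU S) subnDr. Qed.

(** The bounds on [\dim U] and [\dim W] leave room for a normal form, so the orbit is nonempty. Any
    other open orbit meets it, and orbits that meet coincide. *)
Lemma unique_open_orbit k l r t :
    (forall s : seq F, exists c : F, c \notin s) -> (k.*2 <= l)%N -> (l <= r)%N ->
    ((l - k).*2 <= \dim U)%N -> ((r - k).*2 <= \dim W)%N ->
    t = (0, r - l, l - k.*2, k.*2)%N -> zariski_open B r (orbitO B U W r t) ->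
  is_unique_open_orbit B U W r (orbitO B U W r t).
Proof.
move=> Finf kl lr lU lW -> oO; have [S iS nS] := normal_form_exists kl lr lU lW.
have OS := normal_form_orbitO kl lr iS nS.
have orb T : orbitO B U W r (0, r - l, l - k.*2, k.*2)%N T <-> H_orbit B U W S T.
  split=> [OT|ST]; last exact: orbitO_stable ST OS.
  have [/andP[_ iT] _] := OT; have [_ iS'] := andP iS.
  by apply: (normal_form_conj lr iS' iT nS); apply: orbitO_normal_form.
split=> //; first by exists S.
move=> X [S0 _ hX] oX T.
have [S1 [/hX X1 /orb O1]] := open_meet Finf Balt Bnondeg oX oO
  ((hX S0).2 (H_orbit_refl S0)) OS.
split=> [/hX X2|/orb O2]; [apply/orb|apply/hX].
  exact: H_orbit_trans O1 (H_orbit_trans (H_orbit_sym X1) X2).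
exact: H_orbit_trans X1 (H_orbit_trans (H_orbit_sym O1) O2).
Qed.

End Decomposition.

(** * Exchanging U and W *)

Section SwapSummands.
Variables (F : fieldType) (V : vectType F) (B : {skew_symmetric V}).
Hypothesis Bnondeg : nondeg_on B fullv.
Variables (U W : {vspace V}).
Hypotheses (UWV : (U + W)%VS = fullv) (UW0 : (U :&: W)%VS = 0%VS).
Hypothesis UperpW : (U <= orthov B W)%VS.
Let WUV : (W + U)%VS = fullv. Proof. by rewrite addvC. Qed.
Let WU0 : (W :&: U)%VS = 0%VS. Proof. by rewrite capvC. Qed.
Let WperpU : (W <= orthov B U)%VS. Proof. by rewrite orthov_sym. Qed.

Lemma H_orbit_swap S T : H_orbit B U W S T <-> H_orbit B W U S T.
Proof.
by split=> -[g [hg ->]]; exists g; split=> //; move: hg;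
  rewrite !in_HP // => -[gB gU gW]; split.
Qed.

Lemma orbitO_swap r i j k l S :
  orbitO B U W r (i, j, k, l) S <-> orbitO B W U r (j, i, k, l) S.
Proof.
have radS : isoGr B r S -> radU B U W S = radU B W U S.
  move=> /andP[_ iS]; apply/eqP; rewrite eqEsubv; apply/andP; split.
    exact: (cap_RadPU_sub iS UperpW).
  exact: (cap_RadPU_sub iS WperpU).
split=> -[iS [<- <- <- <-]]; split=> //; rewrite !a_radU // !b_radU // radS //.
  by rewrite [(rU U S + _)%N]addnC.
by rewrite [(rU W S + _)%N]addnC.
Qed.

Lemma unique_open_orbit_swap r i j k l :
  is_unique_open_orbit B W U r (orbitO B W U r (j, i, k, l)) ->
  is_unique_open_orbit B U W r (orbitO B U W r (i, j, k, l)).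
Proof.
case=> [[S iS hS] [_ [I [Ihom hI]]] uniq]; split.
- by exists S => // T; rewrite orbitO_swap H_orbit_swap.
- split=> [T []//|]; exists I; split=> // T; rewrite -hI.
  by split=> -[iT h]; split=> // /orbitO_swap.
- move=> X [T iT hT] oX Z; rewrite orbitO_swap; apply: uniq => //.
  by exists T => // Z'; rewrite hT H_orbit_swap.
Qed.

End SwapSummands.

(** * Symplectic forms and the conclusion *)

(** Outside characteristic 2, skew-symmetry gives 2 B u u = 0; in characteristic 2, alternation is a
    clause of [is_psymplectic]. *)
Lemma psymplectic_alt (F : fieldType) (V : vectType F) (B : {skew_symmetric V}) :
  is_psymplectic B -> forall u, B u u = 0.
Proof.
case=> _ _ alt2 u; have [two|two] := boolP (2%N \in [pchar F]); first exact: alt2.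
have /eqP : B u u = - B u u by exact: skewC.
rewrite -addr_eq0 -mulr2n -mulr_natr mulf_eq0 => /orP[/eqP//|e].
by move: two; rewrite inE /= e.
Qed.

Lemma psymplectic_nondeg (F : fieldType) (V : vectType F) (B : {skew_symmetric V}) :
  is_psymplectic B -> nondeg_on B fullv.
Proof.
case=> /eqP nd _ _ u _ h; apply/eqP; rewrite -memv0 -nd.
by apply/mem_orthovP.
Qed.

Theorem corollary3p4
    (F : fieldType) (F_infinite : forall s : seq F, exists x, x \notin s)
    (V : vectType F) (n m r : nat) (dim_V : \dim {:V} = (2 * n)%N)
    (B : {skew_symmetric V}) (B_symplectic : is_psymplectic B)
    (U W : {vspace V})
    (V_sum : (U + W)%VS = fullv) (V_direct : (U :&: W)%VS = 0%VS)
    (U_perp_W : (U <= orthov B W)%VS)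
    (dim_U : \dim U = (2 * m)%N) (dim_W : \dim W = (2 * n - 2 * m)%N)
    (m_gt0 : (0 < m)%N) (m_lt_n : (m < n)%N) (r_le_n : (r <= n)%N) :
  ((r < minn (2 * m) (2 * n - 2 * m))%N ->
     (~~ odd r ->
        is_unique_open_orbit B U W r (orbitO B U W r (0, 0, 0, r)%N)) /\
     (odd r ->
        is_unique_open_orbit B U W r (orbitO B U W r (0, 0, 1, r - 1)%N))) /\
  ((minn (2 * m) (2 * n - 2 * m) <= r)%N ->
     ((m <= n - m)%N ->
        is_unique_open_orbit B U W r
          (orbitO B U W r (0, r - 2 * m, 0, 2 * m)%N)) /\
     ((n - m <= m)%N ->
        is_unique_open_orbit B U W r
          (orbitO B U W r (r - (2 * n - 2 * m), 0, 0, 2 * n - 2 * m)%N))).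
Proof.
have Balt := psymplectic_alt B_symplectic.
have Bnd := psymplectic_nondeg B_symplectic.
have V_sum' : (W + U)%VS = fullv by rewrite addvC.
have V_direct' : (W :&: U)%VS = 0%VS by rewrite capvC.
have W_perp_U : (W <= orthov B U)%VS by rewrite orthov_sym.
have generic k : (k.*2 <= r)%N -> (r - k.*2 <= 1)%N ->
    (r < minn (2 * m) (2 * n - 2 * m))%N ->
    is_unique_open_orbit B U W r (orbitO B U W r (0, 0, r - k.*2, k.*2)%N).
  move=> kr rk lt; apply: (@unique_open_orbit _ _ _ _ _ _ _ _ _ _ k r) => //.
  (* For odd r the normal form needs r + 1 dimensions in each summand, which the strict bound on r
     provides. *)
  - by rewrite dim_U; lia.
  - by rewrite dim_W; lia.
  - by rewrite subnn.
  - exact: open_generic.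
split=> [lt|ge]; split=> [er|er].
- have := generic r./2; have -> : r./2.*2 = r by lia.
  by rewrite subnn; apply.
- have := generic r./2; have -> : r./2.*2 = (r - 1)%N by lia.
  have -> : (r - (r - 1) = 1)%N by lia.
  by apply => //; lia.
- rewrite mul2n in dim_U ge *.
  apply: (@unique_open_orbit _ _ _ _ _ _ _ _ _ _ m m.*2) => //.
  + by lia.
  + by rewrite dim_U; lia.
  (* The room required in W is 2 (r - m) <= 2n - 2m, which is the condition r <= n. *)
  + by rewrite dim_W; lia.
  + by rewrite subnn.
  + by apply: open_full => //; lia.
- apply: unique_open_orbit_swap => //.
  have e : (2 * n - 2 * m = (n - m).*2)%N by lia.
  rewrite e in dim_W ge *.
  apply: (@unique_open_orbit _ _ _ _ _ _ _ _ _ _ (n - m) (n - m).*2) => //.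
  + by lia.
  + by rewrite dim_W; lia.
  + by rewrite dim_U; lia.
  + by rewrite subnn.
  + by apply: open_full => //; lia.
Qed.
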